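(* Let $1\le k<d$ be integers. Suppose $S\subset\mathbb{R}^{(k+1)(d-k)}$ is a compact set with Hausdorff dimension $\alpha>(k+1)(d-k)-k$. Then $$\bigcup_{y\in S}\pi_y$$ has positive Lebesgue measure in $\mathbb{R}^d$.
   Context: Write $y=(y_i^j)$, where $i=0,\dots,k$ and $j=1,\dots,d-k$, for an element of $\mathbb{R}^{(k+1)(d-k)}$. For such $y$, $\pi_y$ denotes the $k$-plane in $\mathbb{R}^d$ given by $$\pi_y=\Big\{\Big(x_1,\dots,x_k,\ y_0^1+\sum_{i=1}^k x_i y_i^1,\ \dots,\ y_0^{d-k}+\sum_{i=1}^k x_i y_i^{d-k}\Big): x=(x_1,\dots,x_k)\in\mathbb{R}^k\Big\}.$$ *)

(* Defs.v *)
From HB Require Import structures.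
From mathcomp Require Import all_boot all_order all_algebra.
From mathcomp Require Import all_classical all_reals all_analysis.

Set Implicit Arguments.
Unset Strict Implicit.
Unset Printing Implicit Defensive.

Import Order.TTheory GRing.Theory Num.Theory.
Import numFieldNormedType.Exports.

Local Open Scope classical_set_scope.
Local Open Scope ring_scope.

(* The library norm on matrices is the sup norm. *)
Definition euclidean_dist (R : realType) (m n : nat) (x y : 'M[R]_(m, n)) : R :=
  Num.sqrt (\sum_i \sum_j (x i j - y i j) ^+ 2).

(* 0 is added so that the diameter of the empty set is 0 and not -oo. *)
Definition diameter (R : realType) (T : Type) (dist : T -> T -> R)
    (U : set T) : \bar R :=
  ereal_sup ([set 0%E] `|` [set (dist p.1 p.2)%:E | p in U `*` U]).

Definition delta_cover (R : realType) (T : Type) (dist : T -> T -> R)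
    (delta : R) (A : set T) : set (set (set T)) :=
  [set C | [/\ countable C,
               forall U, C U -> (diameter dist U <= delta%:E)%E
             & A `<=` \bigcup_(U in C) U]].

Definition hausdorff_premeasure (R : realType) (T : Type) (dist : T -> T -> R)
    (s delta : R) (A : set T) : \bar R :=
  ereal_inf [set (\esum_(U in C) poweR (diameter dist U) s)%E
            | C in delta_cover dist delta A].

Definition hausdorff_measure (R : realType) (T : Type) (dist : T -> T -> R)
    (s : R) (A : set T) : \bar R :=
  ereal_sup [set hausdorff_premeasure dist s delta A
            | delta in [set delta : R | 0 < delta]].

Definition hausdorff_dim (R : realType) (T : Type) (dist : T -> T -> R)
    (A : set T) : \bar R :=
  ereal_inf [set s%:E | s in
    [set s : R | 0 <= s /\ hausdorff_measure dist s A = 0%E]].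

(* A pair of vectors (a, b) encodes the half-open box with sides ]a_i, b_i]. *)
Definition box (R : realType) (n : nat) (ab : 'rV[R]_n * 'rV[R]_n) :
    set 'rV[R]_n :=
  [set x | forall i, ab.1 0 i < x 0 i <= ab.2 0 i].

Definition box_volume (R : realType) (n : nat) (ab : 'rV[R]_n * 'rV[R]_n) : R :=
  \prod_i (ab.2 0 i - ab.1 0 i).

Definition box_cover (R : realType) (n : nat) (A : set 'rV[R]_n) :
    set (set ('rV[R]_n * 'rV[R]_n)) :=
  [set B : set ('rV[R]_n * 'rV[R]_n) |
    [/\ countable B,
        forall ab, B ab -> forall i, ab.1 0 i <= ab.2 0 i
      & A `<=` \bigcup_(ab in B) box ab]].

Definition lebesgue_outer (R : realType) (n : nat) (A : set 'rV[R]_n) : \bar R :=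
  ereal_inf [set (\esum_(ab in B) (box_volume ab)%:E)%E | B in box_cover A].

Section lebesgue_outer_measure.
Local Open Scope ereal_scope.
Context {R : realType} {n : nat}.
Local Notation V := 'rV[R]_n.
Local Notation mu := (@lebesgue_outer R n).

Let box_volume_ge0 (A : set V) (B : set (V * V)) ab : box_cover A B -> B ab ->
  0 <= (box_volume ab)%:E.
Proof.
move=> [_ + _] Bab => /(_ _ Bab) ab_le.
by rewrite lee_fin; apply: prodr_ge0 => i _; rewrite subr_ge0.
Qed.

Let lebesgue_outer_ge0 A : 0 <= mu A.
Proof.
apply: le_ereal_inf_tmp => _ [B AB <-].
by apply: esum_ge0 => ab; exact: box_volume_ge0 AB.
Qed.

Let lebesgue_outer0 : mu set0 = 0.
Proof.
apply/eqP; rewrite eq_le lebesgue_outer_ge0 andbT.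
by apply: ereal_inf_lbound; exists set0; [split|rewrite esum_set0].
Qed.

Let le_lebesgue_outer : {homo mu : A B / A `<=` B >-> A <= B}.
Proof.
move=> A A' AA'; apply/ereal_inf_le_tmp => _ [B [cB B_le A'B] <-].
by exists B => //; split => //; exact: subset_trans A'B.
Qed.

Let lebesgue_outer_sigma_subadditive : sigma_subadditive mu.
Proof.
move=> A; have [[i ioo]|] := pselect (exists i, mu (A i) = +oo).
  rewrite (eseries_pinfty _ _ ioo) ?leey// => k _.
  by rewrite -ltNye (lt_le_trans _ (lebesgue_outer_ge0 _)).
rewrite -forallNE => Aoo.
suff add2e (e : {posnum R}) :
    mu (\bigcup_n A n) <= \sum_(i <oo) mu (A i) + e%:num%:E.
  by apply/lee_addgt0Pr => _/posnumP[].
rewrite (le_trans _ (epsilon_trick _ _ _))//.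
pose P k (B : set (V * V)) := box_cover (A k) B /\
  \esum_(ab in B) (box_volume ab)%:E <= mu (A k) + (e%:num / (2 ^ k.+1)%:R)%:E.
have [G PG] : {G : nat -> set (V * V) & forall k, P k (G k)}.
  apply: (@choice _ _ P) => k.
  have muAk : mu (A k) \is a fin_num.
    by rewrite ge0_fin_numE// ltey; exact/eqP/Aoo.
  have ek : (0 < e%:num / (2 ^ k.+1)%:R)%R by [].
  have [_ [B AB <-] /ltW leB] := lb_ereal_inf_adherent ek muAk.
  by exists B.
pose F := seqDU G.
have FG k : F k `<=` G k by exact: subset_seqDU.
apply: (@le_trans _ _ (\esum_(ab in \bigcup_k G k) (box_volume ab)%:E)).
  apply: ereal_inf_lbound; exists (\bigcup_k G k) => //; split.
  - by apply: bigcup_countable => // k _; have [[]] := PG k.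
  - by move=> ab [k _ Gab]; have [[_ + _] _] := PG k; exact.
  - move=> x [k _ Akx]; have [[_ _ /(_ _ Akx)[ab Gab abx]] _] := PG k.
    by exists ab => //; exists k.
rewrite seqDU_bigcup_eq -/F.
rewrite esum_bigcup; last 2 first.
- by apply: sub_trivIset (trivIset_seqDU G).
- move=> ab [k _ /FG Gab]; have [AG _] := PG k; exact: box_volume_ge0 AG Gab.
have esum_pos k : 0 <= \esum_(ab in F k) (box_volume ab)%:E.
  apply: esum_ge0 => ab /FG Gab; have [AG _] := PG k.
  exact: box_volume_ge0 AG Gab.
rewrite -nneseries_esumT//; apply: lee_nneseries => // k _.
have [AG] := PG k; apply: le_trans.
apply: ge_ereal_sup => _ [X [finX XF] <-]; apply: esum_ge.
by exists X => //; split => //; exact: subset_trans XF (FG k).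
Qed.

HB.instance Definition _ := isOuterMeasure.Build R V mu lebesgue_outer0
  lebesgue_outer_ge0 le_lebesgue_outer lebesgue_outer_sigma_subadditive.

End lebesgue_outer_measure.

(* Lebesgue measure on R^n: the restriction of the outer measure to its
   Caratheodory sets, i.e., to the (complete) Lebesgue sigma-algebra. *)
Definition lebesgue_measure_rV (R : realType) (n : nat) :
    set (caratheodory_type (@lebesgue_outer R n)) -> \bar R :=
  @lebesgue_outer R n.

HB.instance Definition _ (R : realType) (n : nat) :=
  isMeasure.Build _ (caratheodory_type (@lebesgue_outer R n)) R
    (@lebesgue_measure_rV R n)
    (@caratheodory_measure0 R _ (@lebesgue_outer R n))
    (@caratheodory_measure_ge0 R _ (@lebesgue_outer R n))
    (@caratheodory_measure_sigma_additive R _ (@lebesgue_outer R n)).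

(* y i j is y_i^{j+1}; the row index i ranges over 0, ..., k. *)
Definition plane_point (R : realType) (k m : nat) (y : 'M[R]_(k.+1, m))
    (x : 'rV[R]_k) : 'rV[R]_(k + m) :=
  row_mx x (\row_j (y ord0 j + \sum_(i < k) x 0 i * y (lift ord0 i) j)).

Definition plane (R : realType) (d k : nat) (hkd : (k < d)%N)
    (y : 'M[R]_(k.+1, d - k)) : set 'rV[R]_d :=
  range (fun x => castmx (erefl 1%N, subnKC (ltnW hkd)) (plane_point y x)).

(* Main.v *)
(* Write P_x y = y_0 + sum_i x_i y_i for the fibre over x of the plane of y.
   If the union is null, the part over [0,1]^k is covered by finitely many boxes
   of total volume eta; let f_x be the indicator of their fibres over x, and
   T f y the mean over x of f_x (P_x y), so that T f = 1 on S.  Let A_j average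
   in the fibre variable over cubes of side 2^-j.  Then T (1 - A_j)^k f is close
   to 1 on S for j = 0 and vanishes on S at the finest scale, so every y in S has
   a scale j at which consecutive values differ by at least c / (j+1)^2; this
   persists on a cell of side about 2^-j / (j+1)^2 around y, because
   1 - (1 - A_j)^k is smooth at scale 2^-j.  The number of such cells is
   controlled by the smoothing estimate
     || T (1 - A_j)^k f ||_2^2 <= C eta (j 2^-j)^k.
   To prove it, expand the square over pairs x, x'.  In each direction i,
   integrating over y_i averages over translations by (x_i - x'_i) y_i, which
   telescopes against one factor 1 - A_j and gains min (1, 2^-j / |x_i - x'_i|).
   Summing over cells gives H^s(S) <= C eta for every s > (k+1)(d-k) - k.
   All integrals are replaced by finite sums: x runs through (1/n) Z^k and the
   fibre variable through (Z/(M+1))^m in units of 1/(n! 2^J), so that every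
   difference x_i - x'_i divides the steps of A_j exactly. *)

Require Import Defs.
From HB Require Import structures.
From mathcomp Require Import all_boot all_order all_algebra.
From mathcomp Require Import all_classical all_reals all_analysis.
From mathcomp Require Import finmap.
From mathcomp Require Import zify ring lra.
Set Implicit Arguments.
Unset Strict Implicit.
Unset Printing Implicit Defensive.
Import Order.TTheory GRing.Theory Num.Theory.
Import numFieldNormedType.Exports.
Local Open Scope classical_set_scope.
Local Open Scope ring_scope.

(** * Convolution on a finite abelian group *)

(** A separate name, so that the product can be convolution; [R^o] makes the functions a module over
    [R]. *)
Definition group_alg (R : realFieldType) (V : finZmodType) := {ffun V -> R^o}.

Section GroupRing.
Variables (R : realFieldType) (V : finZmodType).
Implicit Types (f g h : group_alg R V) (u v w : V).

HB.instance Definition _ := GRing.Lmodule.on (group_alg R V).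

Definition conv f g : group_alg R V := [ffun v => \sum_w f w * g (v - w)].
(* The sign makes [transl w * f] the function [fun v => f (v + w)]. *)
Definition transl w : group_alg R V := [ffun v => (v == - w)%:R].

Lemma sum_delta (F : V -> R) w : \sum_v (v == w)%:R * F v = F w.
Proof.
rewrite (bigD1 w) //= eqxx mul1r big1 ?addr0 // => v /negPf ->.
by rewrite mul0r.
Qed.

Lemma convC : commutative conv.
Proof.
move=> f g; apply/ffunP => v; rewrite !ffunE.
rewrite (reindex_inj (can_inj (subKr v))) /=.
by apply: eq_bigr => w _; rewrite subKr mulrC.
Qed.

Lemma convA : associative conv.
Proof.
move=> f g h; apply/ffunP => v; rewrite !ffunE.
transitivity (\sum_w \sum_u f u * (g (w - u) * h (v - w))).
  rewrite exchange_big /=; apply: eq_bigr => u _.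
  rewrite ffunE mulr_sumr (reindex_inj (addIr (- u))) /=.
  by apply: eq_bigr => w _; rewrite opprB addrA addrNK.
apply: eq_bigr => w _; rewrite ffunE mulr_suml.
by apply: eq_bigr => u _; rewrite mulrA.
Qed.

Lemma conv1 : left_id (transl 0) conv.
Proof.
move=> f; apply/ffunP => v; rewrite !ffunE.
under eq_bigr do rewrite ffunE oppr0.
by rewrite sum_delta subr0.
Qed.

Lemma convDl : left_distributive conv +%R.
Proof.
move=> f g h; apply/ffunP => v; rewrite !ffunE -big_split /=.
by apply: eq_bigr => w _; rewrite ffunE mulrDl.
Qed.

Lemma conv_oner_neq0 : transl 0 != 0 :> group_alg R V.
Proof.
apply/eqP => /ffunP/(_ 0)/eqP; rewrite !ffunE oppr0 eqxx.
by rewrite (oner_eq0 R).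
Qed.

HB.instance Definition _ := GRing.Zmodule_isComNzRing.Build (group_alg R V)
  convA convC conv1 convDl conv_oner_neq0.

Lemma conv_scaleAl (a : R) f g : a *: (f * g) = (a *: f) * g.
Proof.
apply/ffunP => v; rewrite !ffunE [LHS]mulr_sumr.
by apply: eq_bigr => w _; rewrite ffunE -mulrA.
Qed.

HB.instance Definition _ := GRing.Lmodule_isLalgebra.Build R (group_alg R V) conv_scaleAl.
HB.instance Definition _ := GRing.Lalgebra_isComAlgebra.Build R (group_alg R V).

Lemma convE f g v : (f * g) v = \sum_w f w * g (v - w).
Proof. by rewrite ffunE. Qed.

Lemma group_alg_addE f g v : (f + g) v = f v + g v. Proof. by rewrite ffunE. Qed.
Lemma group_alg_oppE f v : (- f) v = - f v. Proof. by rewrite ffunE. Qed.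
Lemma group_alg_subE f g v : (f - g) v = f v - g v.
Proof.
by rewrite group_alg_addE group_alg_oppE.
Qed.

Lemma translM w f v : (transl w * f) v = f (v + w).
Proof.
rewrite convE; under eq_bigr do rewrite ffunE.
by rewrite (sum_delta (fun u => f (v - u))) opprK.
Qed.

Lemma translD u w : transl (u + w) = transl u * transl w.
Proof.
by apply/ffunP => v; rewrite translM !ffunE -subr_eq0 -(subr_eq0 _ (- w)) !opprK addrA.
Qed.

Lemma transl0 : transl 0 = 1. Proof. by []. Qed.

Lemma translMn w n : transl (w *+ n) = transl w ^+ n.
Proof. by elim: n => [|n IH]; rewrite ?mulr0n // mulrS translD IH exprS. Qed.

Lemma transl_sum (I : Type) (r : seq I) (P : pred I) (F : I -> V) :
  transl (\sum_(i <- r | P i) F i) = \prod_(i <- r | P i) transl (F i).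
Proof. exact: (big_morph _ translD transl0). Qed.

Definition l1 f : R := \sum_v `|f v|.

Lemma l1_ge0 f : 0 <= l1 f. Proof. exact: sumr_ge0. Qed.

Lemma l1D f g : l1 (f + g) <= l1 f + l1 g.
Proof. by rewrite -big_split /=; apply: ler_sum => v _; rewrite ffunE ler_normD. Qed.

Lemma l1N f : l1 (- f) = l1 f.
Proof. by apply: eq_bigr => v _; rewrite ffunE normrN. Qed.

Lemma l1B f g : l1 (f - g) <= l1 f + l1 g.
Proof. by rewrite -(l1N g) l1D. Qed.

Lemma l1Z (a : R) f : l1 (a *: f) = `|a| * l1 f.
Proof. by rewrite /l1 mulr_sumr; apply: eq_bigr => v _; rewrite ffunE normrM. Qed.

Lemma l1_sum (I : Type) (r : seq I) (P : pred I) (F : I -> group_alg R V) :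
  l1 (\sum_(i <- r | P i) F i) <= \sum_(i <- r | P i) l1 (F i).
Proof.
elim/big_ind2: _ => // [|x a y b hx hy].
  by rewrite /l1 big1 // => v _; rewrite ffunE normr0.
exact: le_trans (l1D _ _) (lerD hx hy).
Qed.

Lemma l1_transl w : l1 (transl w) = 1.
Proof.
rewrite /l1 (bigD1 (- w)) //= big1 ?addr0 => [|v /negPf vw].
  by rewrite ffunE eqxx normr1.
by rewrite ffunE vw normr0.
Qed.

Lemma l1M f g : l1 (f * g) <= l1 f * l1 g.
Proof.
rewrite /l1 mulr_suml.
apply: (@le_trans _ _ (\sum_v \sum_w `|f w| * `|g (v - w)|)).
  apply: ler_sum => v _; rewrite convE; apply: le_trans (ler_norm_sum _ _ _) _.
  by under eq_bigr do rewrite normrM.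
rewrite exchange_big /=; apply: ler_sum => w _; rewrite -mulr_sumr ler_wpM2l //.
by rewrite [leRHS](reindex_inj (addIr (- w))).
Qed.

Lemma l1_prod (I : Type) (r : seq I) (P : pred I) (F : I -> group_alg R V) (c : I -> R) :
  (forall i, P i -> l1 (F i) <= c i) ->
  l1 (\prod_(i <- r | P i) F i) <= \prod_(i <- r | P i) c i.
Proof.
move=> Fc; elim/big_ind2: _ => [|x a y b hx hy|i Pi]; last exact: Fc.
  by rewrite -transl0 l1_transl.
by apply: le_trans (l1M _ _) _; rewrite ler_pM ?l1_ge0.
Qed.

Lemma l1X f n (c : R) : l1 f <= c -> l1 (f ^+ n) <= c ^+ n.
Proof.
move=> fc; elim: n => [|n IH]; first by rewrite expr0 -transl0 l1_transl.
by rewrite !exprS; apply: le_trans (l1M _ _) _; rewrite ler_pM ?l1_ge0.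
Qed.

Lemma conv_bound f g v (c : R) : (forall v, `|g v| <= c) -> `|(f * g) v| <= l1 f * c.
Proof.
move=> gc; rewrite convE mulr_suml; apply: le_trans (ler_norm_sum _ _ _) _.
by apply: ler_sum => w _; rewrite normrM ler_wpM2l.
Qed.

Definition inner f g : R := \sum_v f v * g v.

(** Summation over the group is translation invariant, so only the difference of the two
    translations matters; in the expanded square this is where the differences x_i - x'_i appear. *)
Lemma inner_transl u w f g : inner (transl u * f) (transl w * g) = inner f (transl (w - u) * g).
Proof.
rewrite /inner [RHS](reindex_inj (addIr u)) /=; apply: eq_bigr => v _.
by rewrite !translM -addrA [u + (w - u)]addrC addrNK.
Qed.

Lemma inner_sumr (I : Type) (r : seq I) (P : pred I) f (F : I -> group_alg R V) :
  inner f (\sum_(i <- r | P i) F i) = \sum_(i <- r | P i) inner f (F i).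
Proof.
rewrite /inner exchange_big /=; apply: eq_bigr => v _.
by rewrite sum_ffunE mulr_sumr.
Qed.

Lemma inner_suml (I : Type) (r : seq I) (P : pred I) f (F : I -> group_alg R V) :
  inner (\sum_(i <- r | P i) F i) f = \sum_(i <- r | P i) inner (F i) f.
Proof.
rewrite /inner exchange_big /=; apply: eq_bigr => v _.
by rewrite sum_ffunE mulr_suml.
Qed.

Lemma inner_bound f g (c : R) : (forall v, `|f v| <= c) -> `|inner f g| <= c * l1 g.
Proof.
move=> fc; rewrite mulr_sumr; apply: le_trans (ler_norm_sum _ _ _) _.
by apply: ler_sum => v _; rewrite normrM ler_wpM2r.
Qed.

(** For [x = transl w] this is the sum of the translations by 0, w, ..., (n - 1) w. *)
Definition geom (x : group_alg R V) (n : nat) := \sum_(t < n) x ^+ t.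

Lemma geom_l1 x n : l1 x <= 1 -> l1 (geom x n) <= n%:R.
Proof.
move=> x1; apply: le_trans (l1_sum _ _ _) _.
rewrite -[n in n%:R]card_ord -sumr_const; apply: ler_sum => i _.
by rewrite -(expr1n _ i); apply: l1X.
Qed.

Lemma geomM x n q : geom x (n * q) = geom (x ^+ q) n * geom x q.
Proof.
rewrite /geom -(big_mkord xpredT) big_nat_mul big_mkord mulr_suml.
apply: eq_bigr => i _; rewrite mulSn addnC -{1}[(i * q)%N]add0n big_addn addKn big_mkord mulr_sumr.
by apply: eq_bigr => j _; rewrite exprD mulnC exprM mulrC.
Qed.

Lemma geom1B x n : (1 - x) * geom x n = 1 - x ^+ n.
Proof. by rewrite /geom -opprB mulNr -subrX1 opprB. Qed.

(** Telescoping: the product equals [geom x t * (1 - x ^+ n)], in which only [t] powers are summed,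
    whatever the length [n]. *)
Lemma geom_shift x n t : l1 x <= 1 -> l1 (geom x n * (1 - x ^+ t)) <= t%:R *+ 2.
Proof.
move=> x1; rewrite -geom1B mulrCA mulrA geom1B; apply: le_trans (l1M _ _) _.
rewrite mulrC -mulr_natr ler_pM ?l1_ge0 ?geom_l1 //.
apply: le_trans (l1B _ _) _; rewrite -{1}transl0 l1_transl -[2%:R]/(1 + 1) lerD2l.
by rewrite -(expr1n _ n); apply: l1X.
Qed.

End GroupRing.

(** * Averages over boxes *)

Section Averages.
Variables (R : realFieldType) (V : finZmodType).
Implicit Types (f g h x y u : group_alg R V) (v w : V).

(* [u] plays the role of the inverse of [x], for translations by negative multiples. *)
Lemma geom_shiftV x u Z t : u * x = 1 -> l1 x <= 1 -> l1 u <= 1 ->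
  l1 (geom u Z * (1 - x ^+ t)) <= t%:R *+ 2.
Proof.
move=> ux x1 u1; have -> : 1 - x ^+ t = - x ^+ t * (1 - u ^+ t).
  have e : x ^+ t * u ^+ t = 1 by rewrite -exprMn mulrC ux expr1n.
  by rewrite mulrBr mulr1 mulNr e; ring.
rewrite mulrCA mulNr l1N; apply: le_trans (l1M _ _) _.
rewrite -[leRHS]mul1r ler_pM ?l1_ge0 ?geom_shift //.
by rewrite -(expr1n _ t); apply: l1X.
Qed.

Definition geom_avg x (W : nat) : group_alg R V := W%:R^-1 *: geom x W.

Lemma geom_avg_l1 x W : l1 x <= 1 -> l1 (geom_avg x W) <= 1.
Proof.
move=> x1; rewrite l1Z ger0_norm ?invr_ge0 //; have [->|W0] := posnP W.
  by rewrite invr0 mul0r.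
by rewrite mulrC ler_pdivrMr ?ltr0n // mul1r geom_l1.
Qed.

Lemma geom_avgM x W L : geom_avg x (W * L) = geom_avg (x ^+ L) W * geom_avg x L.
Proof. by rewrite /geom_avg geomM natrM invfM -scalerAl -scalerAr scalerA. Qed.

Lemma one_sub_geom_avg x W : (0 < W)%N -> 1 - geom_avg x W = W%:R^-1 *: \sum_(t < W) (1 - x ^+ t).
Proof.
move=> W0; rewrite big_split /= sumr_const card_ord scalerDr sumrN scalerN; congr (_ - _).
by rewrite -[X in _ *: X]scaler_nat scalerA mulVf ?scale1r ?pnatr_eq0 -?lt0n.
Qed.

(** 1 minus an average of powers is the average of the 1 - x^t, so a bound uniform in t < W
    suffices. *)
Lemma geom_avg_shift y x W (c : R) : (0 < W)%N ->
  (forall t, (t < W)%N -> l1 (y * (1 - x ^+ t)) <= c) -> l1 (y * (1 - geom_avg x W)) <= c.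
Proof.
move=> W0 yc; rewrite one_sub_geom_avg // -scalerAr l1Z ger0_norm ?invr_ge0 //.
rewrite mulrC ler_pdivrMr ?ltr0n // mulr_sumr; apply: le_trans (l1_sum _ _ _) _.
rewrite -[W in W%:R]card_ord mulr_natr -sumr_const.
by apply: ler_sum => t _; apply: yc.
Qed.

(** The identity 1 - y z = (1 - y) + y (1 - z) replaces the factors one at a time; each 1 - y_i is
    absorbed by its own G_i, and the other G_j contribute powers of c. *)
Lemma prod_shift (I : Type) (r : seq I) (G y : I -> group_alg R V) (c : R) (d : I -> R) :
  (forall i, l1 (G i) <= c) -> (forall i, l1 (y i) <= 1) ->
  (forall i, l1 (G i * (1 - y i)) <= c * d i) ->
  l1 (\prod_(i <- r) G i * (1 - \prod_(i <- r) y i)) <= c ^+ size r * \sum_(i <- r) d i.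
Proof.
move=> Gc y1 Gd; elim: r => [|i r IH].
  by rewrite !big_nil subrr mulr0 mulr0 /l1 big1 // => v _; rewrite ffunE normr0.
rewrite !big_cons /=; set g := \prod_(j <- r) G j in IH *; set z := \prod_(j <- r) y j in IH *.
have gc : l1 g <= c ^+ size r.
  have := @l1_prod _ _ _ r xpredT G (fun=> c) (fun i _ => Gc i).
  by rewrite big_const_seq count_predT iter_mulr_1.
have -> : G i * g * (1 - y i * z) = g * (G i * (1 - y i)) + G i * y i * (g * (1 - z)) by ring.
have c0 : 0 <= c := le_trans (l1_ge0 _) (Gc i).
apply: le_trans (l1D _ _) _.
have -> : c ^+ (size r).+1 * (d i + \sum_(j <- r) d j)
    = c ^+ size r * (c * d i) + c * 1 * (c ^+ size r * \sum_(j <- r) d j).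
  by rewrite exprSr; ring.
apply: lerD; apply: le_trans (l1M _ _) _; rewrite ler_pM ?l1_ge0 //.
by apply: le_trans (l1M _ _) _; rewrite ler_pM ?l1_ge0.
Qed.

End Averages.

Lemma prod_const_ord (R : realFieldType) (m : nat) (c : R) : \prod_(l < m) c = c ^+ m.
Proof. by rewrite prodr_const card_ord. Qed.

(** * The square-sum estimate for sums over slices *)

Section L2.
Variables (R : realFieldType) (V : finZmodType) (m : nat) (g : 'I_m -> V).
Implicit Types (b : int).

Definition box_point N (t : {ffun 'I_m -> 'I_N}) : V := \sum_l g l *+ t l.
(** [box_sum] and [box_avg] are products over the coordinates, so that the one-dimensional
    telescoping applies in each; [box_sumE] expands the former as a sum over a box. *)
Definition box_sum (Z : nat) b : group_alg R V := \prod_l geom (transl R (g l *~ b)) Z.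
Definition box_avg (L W : nat) : group_alg R V := \prod_l geom_avg (transl R (g l *+ L)) W.

Lemma box_sumE Z b : box_sum Z b = \sum_(t : {ffun 'I_m -> 'I_Z}) transl R (box_point t *~ b).
Proof.
rewrite /box_sum /geom bigA_distr_bigA /=; apply: eq_bigr => t _.
rewrite /box_point mulrz_suml transl_sum; apply: eq_bigr => l _.
by rewrite -translMn !pmulrn -!mulrzA mulrC.
Qed.

Lemma box_avg_l1 L W : l1 (box_avg L W) <= 1.
Proof.
apply: le_trans (@l1_prod _ _ _ _ _ _ (fun=> 1) _) _; last by rewrite big1.
by move=> i _; apply: geom_avg_l1; rewrite l1_transl.
Qed.

(** A cube of side [W * L] is tiled by the translates of a cube of side [L] along a lattice of step
    [L]. *)
Lemma box_avgM W L : box_avg 1 (W * L) = box_avg L W * box_avg 1 L.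
Proof.
rewrite -big_split /=; apply: eq_bigr => l _.
by rewrite geom_avgM -translMn.
Qed.

Lemma box_sum_l1 Z b : l1 (box_sum Z b) <= Z%:R ^+ m.
Proof.
rewrite -prod_const_ord; apply: l1_prod => l _; apply: geom_l1.
by rewrite l1_transl.
Qed.

(** With L = c |b|, a translation by t steps of [box_avg] is one by c t steps of [box_sum], so
    telescoping leaves at most 2 c t out of Z terms. As t < W, the m coordinates together give 2 m c
    W / Z. *)
Lemma box_sum_avg_l1 Z L W b : (0 < W)%N -> (0 < Z)%N -> (`|b| %| L)%N -> b != 0 ->
  l1 (box_sum Z b * (1 - box_avg L W)) <= Z%:R ^+ m * ((2 * m * (L * W))%:R / (`|b|%N * Z)%:R).
Proof.
move=> W0 Z0 /dvdnP[c Lc] b0.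
have bN0 : (0 < `|b|)%N by rewrite absz_gt0.
apply: (@le_trans _ _ (Z%:R ^+ m * (\sum_(l < m) (c * W * 2)%:R / Z%:R))).
  have -> : Z%:R ^+ m = Z%:R ^+ size (index_enum 'I_m) :> R.
    by rewrite -[index_enum _]filter_predT size_filter -sum1_count sum1_card card_ord.
  apply: prod_shift => l.
  - by apply: geom_l1; rewrite l1_transl.
  - by apply: geom_avg_l1; rewrite l1_transl.
  rewrite mulrCA divff ?pnatr_eq0 -?lt0n // mulr1; apply: geom_avg_shift => // t tW.
  apply: (@le_trans _ _ ((c * t)%:R *+ 2)); last first.
    by rewrite -mulrnA ler_nat !leq_mul // ltnW.
  have -> : transl R (g l *+ L) ^+ t = transl R (g l *+ `|b|) ^+ (c * t).
    by rewrite -!translMn -!mulrnA Lc; congr (transl _ (_ *+ _)); ring.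
  (* For negative [b] the progression of [box_sum] runs through the inverse translations. *)
  case: b {b0 Lc bN0} => b /=.
    by apply: geom_shift; rewrite l1_transl.
  apply: geom_shiftV; rewrite ?l1_transl // -translD.
  by rewrite NegzE mulrNz -pmulrn addNr transl0.
rewrite sumr_const card_ord -mulr_natr Lc.
rewrite le_eqVlt; apply/orP; left; apply/eqP; rewrite !natrM; field.
by rewrite !pnatr_eq0 -!lt0n bN0 Z0.
Qed.

Variables (k n Z : nat) (P : group_alg R V) (theta : nat -> R) (Theta : R).
Variable f : {ffun 'I_k -> 'I_n} -> group_alg R V.
Hypothesis Ptheta : forall b, (`|b| < n)%N -> l1 (box_sum Z b * P) <= Z%:R ^+ m * theta `|b|.
Hypothesis P2 : l1 P <= 2.
Hypothesis thetaE : forall i : 'I_n, \sum_(j < n) theta `|i%:Z - j%:Z| <= Theta.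
Hypothesis f1 : forall a v, `|f a v| <= 1.

(** At v this is the sum over a of F_a (v + sum_i a_i z_i): the values of F along the plane with
    base v and parameters z_i. *)
Definition slice_sum (F : {ffun 'I_k -> 'I_n} -> group_alg R V) (z : 'I_k -> V) : group_alg R V :=
  \sum_(a : {ffun 'I_k -> 'I_n}) transl R (\sum_i z i *+ a i) * F a.

Lemma theta_ge0 b : (`|b| < n)%N -> (0 < Z)%N -> 0 <= theta `|b|.
Proof.
move=> bn Z0; have := le_trans (l1_ge0 _) (Ptheta bn).
by rewrite pmulr_rge0 // exprn_gt0 // ltr0n.
Qed.

Lemma ord_dist_lt (i j : 'I_n) : (`|i%:Z - j%:Z| < n)%N.
Proof. have := ltn_ord i; have := ltn_ord j; lia. Qed.

(* The [f a] are bounded by 1, so in the expanded square one factor is bounded in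
   sup norm and the other in l1; no l2 operator norm is needed. *)
Lemma slice_sum_l2 : (0 < Z)%N ->
  \sum_(t : {ffun 'I_k -> {ffun 'I_m -> 'I_Z}})
    \sum_v (slice_sum (fun a => P ^+ k * f a) (fun i => box_point (t i)) v) ^+ 2
  <= 2 ^+ k * (Z%:R ^+ m * Theta) ^+ k * \sum_a l1 (f a).
Proof.
move=> Z0; set G := fun a => P ^+ k * f a.
have G2 a v : `|G a v| <= 2 ^+ k.
  by apply: le_trans (conv_bound _ _ (f1 a)) _; rewrite mulr1 l1X.
(* Opening the square leaves pairs (a, a'); summing over [t i] then turns the translations into one
   box sum for each direction i. *)
have -> : \sum_(t : {ffun 'I_k -> {ffun 'I_m -> 'I_Z}})
    \sum_v (slice_sum G (fun i => box_point (t i)) v) ^+ 2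
  = \sum_(a : {ffun 'I_k -> 'I_n}) \sum_(a' : {ffun 'I_k -> 'I_n})
      inner (G a) ((\prod_i box_sum Z ((a' i)%:Z - (a i)%:Z)) * G a').
  transitivity (\sum_(t : {ffun 'I_k -> {ffun 'I_m -> 'I_Z}}) \sum_(a : {ffun 'I_k -> 'I_n})
     \sum_(a' : {ffun 'I_k -> 'I_n})
       inner (G a) (transl R (\sum_i box_point (t i) *~ ((a' i)%:Z - (a i)%:Z)) * G a')).
    apply: eq_bigr => t _; rewrite -[LHS]/(inner _ _) /slice_sum inner_suml;
      apply: eq_bigr => a _.
    rewrite inner_sumr; apply: eq_bigr => a' _; rewrite inner_transl -sumrB.
    by congr (inner _ (transl _ _ * _)); apply: eq_bigr => i _; rewrite mulrzBr -!pmulrn.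
  rewrite exchange_big /=; apply: eq_bigr => a _.
  rewrite exchange_big /=; apply: eq_bigr => a' _.
  rewrite -inner_sumr -mulr_suml; congr (inner _ (_ * _)).
  under [RHS]eq_bigr do rewrite box_sumE.
  by rewrite bigA_distr_bigA /=; apply: eq_bigr => t _; rewrite transl_sum.
rewrite exchange_big /= mulr_sumr; apply: ler_sum => a' _.
apply: (@le_trans _ _ (\sum_(a : {ffun 'I_k -> 'I_n})
  2 ^+ k * ((\prod_i (Z%:R ^+ m * theta `|(a' i)%:Z - (a i)%:Z|)) * l1 (f a')))).
  apply: ler_sum => a _; apply: le_trans (ler_norm _) _.
  apply: le_trans (inner_bound _ (G2 a)) _; rewrite ler_wpM2l ?exprn_ge0 //.
  (* Each of the k directions receives one of the k factors of [P ^+ k]; this is the reason for the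
     exponent. *)
  rewrite /G mulrA -[X in P ^+ X]card_ord -prodr_const -big_split /=.
  apply: le_trans (l1M _ _) _; rewrite ler_wpM2r ?l1_ge0 //.
  by apply: l1_prod => i _; apply: Ptheta; apply: ord_dist_lt.
rewrite -mulr_sumr -mulrA ler_wpM2l ?exprn_ge0 // -mulr_suml ler_wpM2r ?l1_ge0 //.
(* For fixed a' the sum over a factors into k sums over a single coordinate. *)
rewrite -(bigA_distr_bigA (fun i (j : 'I_n) => Z%:R ^+ m * theta `|(a' i)%:Z - j%:Z|)) /=.
rewrite -(prod_const_ord k (Z%:R ^+ m * Theta)).
apply: ler_prod => i _; apply/andP; split.
  apply: sumr_ge0 => j _; rewrite mulr_ge0 ?exprn_ge0 // theta_ge0 //; exact: ord_dist_lt.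
by rewrite -mulr_sumr ler_wpM2l ?exprn_ge0.
Qed.

End L2.

(** * The discretized family of planes *)

Section Weights.
Variable R : realFieldType.

(* [truncated_inv c b] is min (1, c / b), with value 1 at b = 0. *)
Definition truncated_inv (c b : nat) : R := if (b <= c)%N then 1 else c%:R / b%:R.

Lemma truncated_inv_ge0 c b : 0 <= truncated_inv c b.
Proof. by rewrite /truncated_inv; case: ifP => // _; rewrite divr_ge0. Qed.

Lemma truncated_inv_le c b d : (0 < d <= b)%N -> truncated_inv c b <= c%:R / d%:R.
Proof.
move=> /andP[d0 db]; rewrite /truncated_inv; case: ifP => bc.
  by rewrite lter_pdivlMr ?ltr0n // mul1r ler_nat (leq_trans db).
by rewrite ler_wpM2l // lef_pV2 ?posrE ?ltr0n ?ler_nat // (leq_trans d0).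
Qed.

(** The initial block and each of the j dyadic blocks contribute at most 2^a. This is the source of
    the logarithmic loss j + 1. *)
Lemma truncated_inv_sum a j : \sum_(b < 2 ^ (a + j)) truncated_inv (2 ^ a) b <= (2 ^ a * j.+1)%:R.
Proof.
elim: j => [|j IH].
  rewrite addn0 muln1 -[X in X%:R]card_ord -sumr_const; apply: ler_sum => b _.
  by rewrite /truncated_inv ltnW.
rewrite -(big_mkord xpredT) (@big_cat_nat _ _ _ (2 ^ (a + j))) //=;
  last by rewrite leq_exp2l // leq_add2l.
rewrite big_mkord mulnS [(2 ^ a + _)%N]addnC natrD lerD //.
apply: (@le_trans _ _ (\sum_(2 ^ (a + j) <= b < 2 ^ (a + j.+1)) (2 ^ a)%:R / (2 ^ (a + j))%:R)).
  apply: ler_sum_nat => b /andP[b1 _].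
  by apply: truncated_inv_le; rewrite expn_gt0.
rewrite sumr_const_nat addnS expnS mul2n -addnn addnK -[leLHS]mulr_natr divfK //.
Qed.

(** Each distance to [i] is attained at most twice, once on either side. *)
Lemma sum_dist_le n (w : nat -> R) (i : 'I_n) : (forall b, 0 <= w b) ->
  \sum_(j < n) w `|i%:Z - j%:Z|%N <= 2 * \sum_(b < n) w b.
Proof.
move=> w0; rewrite -(big_mkord xpredT (fun j => w `|i%:Z - j%:Z|%N)) -(big_mkord xpredT w).
rewrite (@big_cat_nat _ _ _ i.+1) //=.
have le_part p : (p <= n)%N -> \sum_(0 <= b < p) w b <= \sum_(0 <= b < n) w b.
  by move=> pn; rewrite [leRHS](@big_cat_nat _ _ _ p) //= lerDl sumr_ge0.
have -> : \sum_(0 <= b < i.+1) w `|i%:Z - b%:Z|%N = \sum_(0 <= b < i.+1) w b.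
  rewrite big_nat_rev /= big_nat [RHS]big_nat; apply: eq_bigr => b /andP[_ bi].
  congr w; lia.
have -> : \sum_(i.+1 <= b < n) w `|i%:Z - b%:Z|%N = \sum_(1 <= b < n - i) w b.
  rewrite -{1}[i.+1]add1n big_addn big_nat [RHS]big_nat.
  by apply: eq_bigr => b /andP[b0 bi]; congr w; lia.
rewrite mulr2n mulrDl mul1r lerD ?le_part //.
have [ni|ni] := leqP (n - i) 1.
  by rewrite [leLHS]big_geq // sumr_ge0.
apply: le_trans (le_part (n - i)%N (leq_subr _ _)).
by rewrite [leRHS](@big_cat_nat _ _ _ 1) ?(ltnW ni) //= lerDr sumr_ge0.
Qed.

End Weights.

Lemma norm_diff4 (R : realFieldType) (p p' q q' t x y : R) :
  `|(p' - p) - t| <= x -> `|(q' - q) - t| <= y -> `|(p' - q') - (p - q)| <= x + y.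
Proof.
move=> px qy; have -> : (p' - q') - (p - q) = ((p' - p) - t) - ((q' - q) - t) by ring.
exact: le_trans (ler_normB _ _) (lerD px qy).
Qed.

Lemma sum_sqrB_le (R : realFieldType) (I I' : finType) (X Y : I -> I' -> R) (a : R) :
  \sum_i \sum_i' X i i' ^+ 2 <= a -> \sum_i \sum_i' Y i i' ^+ 2 <= a ->
  \sum_i \sum_i' (X i i' - Y i i') ^+ 2 <= 4 * a.
Proof.
move=> Xa Ya.
apply: (@le_trans _ _ (2 * (\sum_i \sum_i' X i i' ^+ 2) + 2 * (\sum_i \sum_i' Y i i' ^+ 2))).
  rewrite !mulr_sumr -big_split /=; apply: ler_sum => i _.
  rewrite !mulr_sumr -big_split /=; apply: ler_sum => i' _.
  have := sqr_ge0 (X i i' + Y i i'); lra.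
by move: Xa Ya; move: (\sum_i _) (\sum_i _) => x y; lra.
Qed.

(* Chosen so that the series telescopes, with sum below 1/2. *)
Definition threshold (R : realFieldType) j : R := (4 * j.+1 * j.+2)%:R^-1.

Lemma threshold_sum (R : realFieldType) p : \sum_(j < p) threshold R j = (1 - p.+1%:R^-1) / 4.
Proof.
elim: p => [|p IH]; first by rewrite big_ord0 invr1 subrr mul0r.
rewrite big_ord_recr /= IH /threshold !natrM -[p.+2%:R]natr1.
have p0 : 0 < p.+1%:R :> R by rewrite ltr0n.
by field; rewrite [1 + p%:R]addrC natr1 !gt_eqF // addr_gt0.
Qed.

(** If every increment stayed below its threshold, telescoping would bound [f 0 - f J] by the sum of
    the thresholds, which is less than 1/2. *)
Lemma threshold_pigeonhole (R : realFieldType) (f : nat -> R) J : f J = 0 -> 2^-1 <= f 0%N ->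
  exists2 j, (j < J)%N & threshold R j <= `|f j - f j.+1|.
Proof.
move=> fJ f0; have [/existsP[j cjle]|/existsPn noj] :=
  boolP [exists j : 'I_J, threshold R j <= `|f j - f j.+1|].
  by exists j.
have : \sum_(j < J) (f j - f j.+1) <= \sum_(j < J) threshold R j.
  by apply: ler_sum => j _; apply: le_trans (ler_norm _) (ltW _); rewrite ltNge noj.
have -> : \sum_(j < J) (f j - f j.+1) = f 0%N.
  rewrite -(big_mkord xpredT (fun j => f j - f j.+1)) -[RHS]subr0 -[X in _ - X]fJ -opprB.
  by rewrite -telescope_sumr // -sumrN; apply: eq_bigr => j _; rewrite opprB.
rewrite threshold_sum => xy; have y0 : 0 < (J.+1%:R)^-1 :> R by rewrite invr_gt0 ltr0n.
move: f0 xy y0; move: (f 0%N) (J.+1%:R^-1) => x y x0 xy y0.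
have : x < 2^-1 by lra.
by rewrite ltNge x0.
Qed.

Lemma sum_inj_le (R : realFieldType) (I I' : finType) (h : I -> I') (G : I' -> R) :
  injective h -> (forall i, 0 <= G i) -> \sum_i G (h i) <= \sum_i G i.
Proof.
move=> hi G0; have <- : \sum_(w in h @: [set: I]%SET) G w = \sum_t G (h t).
  rewrite big_imset /=; last exact: in2W hi.
  by apply: eq_bigl => t; rewrite inE.
by rewrite [leRHS](bigID [in h @: [set: I]%SET]) /= lerDl sumr_ge0.
Qed.

(* One unit of the grid is 1/U; the parameters y_i with i >= 1 live on the n times
   coarser grid of step 1/D, so that x_i y_i is again a multiple of 1/U.  The size
   M + 1 of the torus is large enough for points coming from |y| <= K not to wrap. *)
Section Grid.
Variables (R : realFieldType) (m k K nu J : nat).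
Let n := (2 ^ nu)%N.
Let L := n`!.
Let D := (n.-1`! * 2 ^ J)%N.
Let U := (L * 2 ^ J)%N.
Let Z := ((2 * K + 1) * D)%N.
Let M := ((k + 1) * (2 * K + 3) * U)%N.
Let V : finZmodType := 'rV['I_M.+1]_m.

(** [inZp] reduces modulo M + 1; by [grid_vecE] nothing is lost for coordinates up to M. *)
Definition grid_vec (u : 'I_m -> nat) : V := \row_l inZp (u l).
Definition grid_gen (l : 'I_m) : V := grid_vec (fun i => (i == l) : nat).

Lemma grid_vecD u w : grid_vec u + grid_vec w = grid_vec (fun l => (u l + w l)%N).
Proof. by apply/rowP => l; rewrite !mxE; apply: val_inj; rewrite /= modnDml modnDmr. Qed.

Lemma grid_vecE u l : (u l <= M)%N -> grid_vec u 0 l = u l :> nat.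
Proof. by move=> uM; rewrite mxE /= modn_small. Qed.

Lemma eq_grid_vec u w : u =1 w -> grid_vec u = grid_vec w.
Proof. by move=> uw; apply/rowP => l; rewrite !mxE uw. Qed.

Lemma grid_vec0 : grid_vec (fun=> 0%N) = 0.
Proof. by apply/rowP => l; rewrite !mxE; apply: val_inj; rewrite /= mod0n. Qed.

Lemma grid_vecMn u a : grid_vec u *+ a = grid_vec (fun l => (u l * a)%N).
Proof.
elim: a => [|a IH]; first by rewrite mulr0n -grid_vec0; apply: eq_grid_vec => l; rewrite muln0.
by rewrite mulrS IH grid_vecD; apply: eq_grid_vec => l; rewrite mulnS.
Qed.

Lemma grid_vec_sum (I : Type) (r : seq I) (u : I -> 'I_m -> nat) :
  \sum_(i <- r) grid_vec (u i) = grid_vec (fun l => \sum_(i <- r) u i l)%N.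
Proof.
elim: r => [|i r IH]; first by rewrite big_nil -grid_vec0; apply: eq_grid_vec => l;
  rewrite big_nil.
by rewrite big_cons IH grid_vecD; apply: eq_grid_vec => l; rewrite big_cons.
Qed.

Lemma grid_vec_gen u : grid_vec u = \sum_l grid_gen l *+ u l.
Proof.
under eq_bigr do rewrite grid_vecMn.
rewrite grid_vec_sum; apply: eq_grid_vec => l; rewrite (bigD1 l) //= eqxx mul1n big1 ?addn0 //.
by move=> i /negPf il; rewrite eq_sym il mul0n.
Qed.

Lemma box_point_vec N (t : {ffun 'I_m -> 'I_N}) : box_point grid_gen t = grid_vec (fun l => t l).
Proof. by rewrite grid_vec_gen. Qed.

Lemma n_gt0 : (0 < n)%N. Proof. by rewrite expn_gt0. Qed.

Lemma nD : (n * D)%N = U.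
Proof.
by rewrite /U /L /D; have := factS n.-1; rewrite prednK ?n_gt0 // => ->; rewrite mulnA.
Qed.

Lemma D_gt0 : (0 < D)%N. Proof. by rewrite muln_gt0 fact_gt0 expn_gt0. Qed.
Lemma U_gt0 : (0 < U)%N. Proof. by rewrite muln_gt0 fact_gt0 expn_gt0. Qed.
Lemma Z_gt0 : (0 < Z)%N. Proof. by rewrite muln_gt0 D_gt0 addn1. Qed.

(* The step of [scale_avg] is n!, a multiple of every difference of grid slopes;
   [fine_avg] fills in the gaps, so that [scale_avg j * fine_avg] is the average over
   a full cube and hence Lipschitz. *)
Definition scale_avg j : group_alg R V := box_avg R grid_gen L (2 ^ (J - j)).
Definition fine_avg : group_alg R V := box_avg R grid_gen 1 L.

Lemma scale_avgJ : scale_avg J = 1.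
Proof.
rewrite /scale_avg subnn expn0 /box_avg big1 // => l _.
by rewrite /geom_avg /geom big_ord1 expr0 invr1 scale1r.
Qed.

Variable F : {ffun 'I_k -> 'I_n} -> ('I_m -> nat) -> bool.
Hypothesis m0 : (0 < m)%N.
Hypothesis k0 : (0 < k)%N.

Definition grid_ind a : group_alg R V := [ffun v : V => (F a (fun l => v 0 l))%:R].

Variable eta : R.
Hypothesis eta_small : 2 ^+ k * eta <= 2^-1.
Hypothesis F_mass : \sum_a l1 (grid_ind a) <= eta * n%:R ^+ k * U%:R ^+ m.

Let T := {ffun 'I_k -> {ffun 'I_m -> 'I_Z}}.

Lemma grid_ind_bound a v : `|grid_ind a v| <= 1.
Proof. by rewrite ffunE; case: F; rewrite ?normr1 ?normr0. Qed.

Lemma fine_avg_l1 : l1 fine_avg <= 1. Proof. exact: box_avg_l1. Qed.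
Lemma scale_avg_l1 j : l1 (scale_avg j) <= 1. Proof. exact: box_avg_l1. Qed.

Lemma one_sub_scale_avg_l1 j : l1 (1 - scale_avg j) <= 2.
Proof.
by apply: le_trans (l1B _ _) _; rewrite -transl0 l1_transl -[2]/(1 + 1) lerD ?scale_avg_l1.
Qed.

Lemma fine_avg_ind_bound a v : `|(fine_avg * grid_ind a) v| <= 1.
Proof.
apply: le_trans (conv_bound _ _ (grid_ind_bound a)) _; rewrite mulr1; exact: fine_avg_l1.
Qed.

Lemma fine_avg_ind_l1 a : l1 (fine_avg * grid_ind a) <= l1 (grid_ind a).
Proof. by apply: le_trans (l1M _ _) _; rewrite ler_piMl ?l1_ge0 ?fine_avg_l1. Qed.

Definition plane_sum (P : group_alg R V) (t : T) : group_alg R V :=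
  slice_sum (fun a => P * (fine_avg * grid_ind a)) (fun i => box_point grid_gen (t i)).

Lemma dvdn_unit b : (0 < b < n)%N -> (b %| L)%N.
Proof. by move=> /andP[b0 bn]; apply: dvdn_fact; rewrite b0 ltnW. Qed.

(** Since Z is a multiple of D, this turns the gain of [box_sum_avg_l1] into a constant times 2^(nu
    - j) / |b|. *)
Lemma scale_unitE j : (j <= J)%N -> (j <= nu)%N -> (L * 2 ^ (J - j) = 2 ^ (nu - j) * D)%N.
Proof.
move=> jJ jn; apply/eqP; rewrite -(@eqn_pmul2r (2 ^ j)) ?expn_gt0 //.
by rewrite -mulnA -expnD subnK // mulnAC -expnD subnK // [X in _ == X]nD.
Qed.

(** The smoothing estimate before normalization. Differences b with |b| <= 2^(nu - j) get the
    trivial bound, the others gain 2^(nu - j) / |b| by telescoping, and summing over b costs the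
    factor j + 1. *)
Lemma plane_sum_l2 j : (j <= J)%N -> (j <= nu)%N ->
  \sum_(t : T) \sum_v (plane_sum ((1 - scale_avg j) ^+ k) t v) ^+ 2
  <= (8 * m)%:R ^+ k * Z%:R ^+ (m * k) * (n%:R ^+ k) ^+ 2 * U%:R ^+ m * eta
     * (j.+1%:R / 2 ^+ j) ^+ k.
Proof.
move=> jJ jn.
have ZD : D%:R / Z%:R <= 1 :> R.
  by rewrite lter_pdivrMr ?ltr0n ?Z_gt0 // mul1r ler_nat leq_pmull // addn1.
have n2 : (2 ^ (nu - j))%:R = n%:R / 2 ^+ j :> R.
  by rewrite -natrX /n -{2}(subnK jn) expnD natrM mulfK // pnatr_eq0 expn_eq0.
pose theta b : R := (2 * m)%:R * truncated_inv R (2 ^ (nu - j)) b.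
apply: le_trans (@slice_sum_l2 R V m grid_gen k n Z (1 - scale_avg j) theta
  ((4 * m * (2 ^ (nu - j) * j.+1))%:R) (fun a => fine_avg * grid_ind a) _ _ _ _ Z_gt0) _.
- move=> b bn; rewrite /theta /truncated_inv; case: ifP => [_|bc].
    rewrite mulr1; apply: le_trans (l1M _ _) _; rewrite ler_pM ?l1_ge0 ?box_sum_l1 //.
    by apply: le_trans (one_sub_scale_avg_l1 j) _; rewrite ler_nat leq_pmulr.
  have b0 : (0 < `|b|)%N by rewrite lt0n; apply: contraFneq bc => ->.
  apply: le_trans (box_sum_avg_l1 _ _ _ _ _ _) _;
    rewrite ?expn_gt0 ?Z_gt0 ?dvdn_unit ?b0 -?absz_gt0 //.
  rewrite ler_wpM2l ?exprn_ge0 // scale_unitE //.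
  have -> : (2 * m * (2 ^ (nu - j) * D))%:R / (`|b| * Z)%:R =
      (2 * m)%:R * ((2 ^ (nu - j))%:R / `|b|%N%:R) * (D%:R / Z%:R) :> R.
    by rewrite !natrM invfM; ring.
  by apply: ler_piMr => //; rewrite mulr_ge0 ?divr_ge0.
- exact: one_sub_scale_avg_l1.
- move=> i; rewrite /theta -mulr_sumr.
  apply: (@le_trans _ _ ((2 * m)%:R * (2 * (2 ^ (nu - j) * j.+1)%:R))); last first.
    by rewrite -natrM -natrM ler_nat; lia.
  rewrite ler_wpM2l //; apply: le_trans (sum_dist_le _ (truncated_inv_ge0 R _)) _.
  rewrite ler_wpM2l //; have := truncated_inv_sum R (nu - j) j.
  by rewrite subnK.
- exact: fine_avg_ind_bound.
apply: (@le_trans _ _ (2 ^+ k * (Z%:R ^+ m * (4 * m * (2 ^ (nu - j) * j.+1))%:R) ^+ k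
   * (eta * n%:R ^+ k * U%:R ^+ m))).
  apply: ler_wpM2l.
    by rewrite mulr_ge0 ?exprn_ge0 ?mulr_ge0 ?exprn_ge0.
  by apply: le_trans F_mass; apply: ler_sum => a _; apply: fine_avg_ind_l1.
rewrite le_eqVlt; apply/orP; left; apply/eqP.
have -> : (4 * m * (2 ^ (nu - j) * j.+1))%:R = (4 * m)%:R * (n%:R * (j.+1%:R / 2 ^+ j)) :> R.
  have -> : n%:R * (j.+1%:R / 2 ^+ j) = (2 ^ (nu - j) * j.+1)%:R :> R by rewrite natrM n2; ring.
  by rewrite -natrM.
have -> : (8 * m)%:R = 2 * (4 * m)%:R :> R by rewrite -natrM; congr (_%:R); lia.
by rewrite exprM !exprMn; ring.
Qed.

(** * Values and regularity of the averages along a single plane *)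

Lemma box_avgE N : box_avg R grid_gen 1 N
  = (N%:R^-1) ^+ m *: \sum_(t : {ffun 'I_m -> 'I_N}) transl R (box_point grid_gen t).
Proof.
rewrite /box_avg /geom_avg /geom scaler_prod prod_const_ord; congr (_ *: _).
rewrite bigA_distr_bigA /=; apply: eq_bigr => t _.
rewrite /box_point transl_sum; apply: eq_bigr => l _.
by rewrite mulr1n translMn.
Qed.

Lemma box_avg_const N (f : group_alg R V) v c : (0 < N)%N ->
  (forall t : {ffun 'I_m -> 'I_N}, f (v + box_point grid_gen t) = c) ->
    (box_avg R grid_gen 1 N * f) v = c.
Proof.
move=> N0 fc; rewrite box_avgE -scalerAl ffunE mulr_suml sum_ffunE.
under eq_bigr do rewrite translM fc.
rewrite sumr_const card_ffun !card_ord -[c *+ _]mulr_natl natrX.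
by rewrite [LHS]mulrA -exprMn mulVf ?expr1n ?mul1r // pnatr_eq0 -lt0n.
Qed.

Lemma box_point_inj N : (N <= M.+1)%N -> injective (@box_point V m grid_gen N).
Proof.
move=> NM s t; rewrite !box_point_vec => /rowP st; apply/ffunP => l; apply: val_inj.
have := congr1 (@nat_of_ord _) (st l); rewrite !mxE /= !modn_small //.
- exact: leq_trans (ltn_ord _) NM.
- exact: leq_trans (ltn_ord _) NM.
Qed.

(** For N <= M + 1 the box does not wrap around the torus, so the average counts each point of the
    torus at most once. *)
Lemma box_avg_sup N (f : group_alg R V) v : (N <= M.+1)%N ->
  `|(box_avg R grid_gen 1 N * f) v| <= (N%:R^-1) ^+ m * l1 f.
Proof.
move=> NM; rewrite box_avgE -scalerAl ffunE normrM ger0_norm ?exprn_ge0 ?invr_ge0 //.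
rewrite ler_wpM2l ?exprn_ge0 ?invr_ge0 // mulr_suml sum_ffunE.
apply: le_trans (ler_norm_sum _ _ _) _; under eq_bigr do rewrite translM.
rewrite /l1 [leRHS](reindex_inj (addrI v)) /=.
exact: (sum_inj_le (box_point_inj NM) (fun w => normr_ge0 (f (v + w)))).
Qed.

(** The cofactor in 1 - (1 - A)^k = A Q for A = [scale_avg j]; through it 1 - (1 - A)^k inherits the
    smoothness of A. *)
Definition scale_rem j : group_alg R V := geom (1 - scale_avg j) k.

Lemma scale_rem_l1 j : l1 (scale_rem j) <= 2 ^+ k.
Proof.
apply: le_trans (l1_sum _ _ _) _.
apply: (@le_trans _ _ (\sum_(i < k) 2 ^+ i)).
  by apply: ler_sum => i _; apply: l1X; apply: one_sub_scale_avg_l1.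
have := subrX1 (2 : R) k; have -> : (2 - 1 = 1 :> R) by ring.
by rewrite mul1r => <-; rewrite lerBlDr lerDl.
Qed.

Lemma scale_remE j : (1 - scale_avg j) ^+ k = 1 - scale_avg j * scale_rem j.
Proof. by have := geom1B (1 - scale_avg j) k; rewrite subKr => ->; rewrite subKr. Qed.

Lemma scale_avg_fine_avg j : (j <= J)%N ->
  scale_avg j * fine_avg = box_avg R grid_gen 1 (2 ^ (J - j) * L).
Proof. by move=> jJ; rewrite box_avgM. Qed.

(** Moving a cube one coordinate at a time, telescoping leaves at most 2 c of N terms in each. *)
Lemma box_avg_lipschitz N w (c : nat) : (0 < N)%N -> (forall l, w l <= c)%N ->
  l1 (box_avg R grid_gen 1 N * (1 - transl R (grid_vec w))) <= (2 * m * c)%:R / N%:R.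
Proof.
move=> N0 wc; rewrite grid_vec_gen transl_sum.
have -> : (2 * m * c)%:R / N%:R
  = 1 ^+ size (index_enum 'I_m) * \sum_(l < m) ((2 * c)%:R / N%:R) :> R.
  by rewrite expr1n mul1r sumr_const card_ord -mulr_natr !natrM; ring.
apply: prod_shift => l.
- by apply: geom_avg_l1; rewrite l1_transl.
- by rewrite l1_transl.
rewrite mul1r mulr1n translMn /geom_avg -scalerAl l1Z ger0_norm ?invr_ge0 // mulrC.
rewrite ler_wpM2r ?invr_ge0 //.
apply: le_trans (geom_shift _ _ _) _; first by rewrite l1_transl.
by rewrite -mulrnA ler_nat mulnC leq_mul2l wc orbT.
Qed.

(** The multiple of A_j is smooth at scale 2^-j, but the term 1 in (1 - A_j)^k is not. The variation
    is therefore compared with that of the unsmoothed function, which cancels between consecutive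
    scales. *)
Lemma scale_diff_lipschitz j a u w (c : nat) : (j <= J)%N -> (forall l, w l <= c)%N ->
  `|(((1 - scale_avg j) ^+ k * (fine_avg * grid_ind a)) (grid_vec u + grid_vec w)
       - ((1 - scale_avg j) ^+ k * (fine_avg * grid_ind a)) (grid_vec u))
     - ((fine_avg * grid_ind a) (grid_vec u + grid_vec w) - (fine_avg * grid_ind a) (grid_vec u))|
  <= 2 ^+ k * ((2 * m * c)%:R * 2 ^+ j / U%:R).
Proof.
move=> jJ wc; set h := fine_avg * grid_ind a.
set N := (2 ^ (J - j) * L)%N.
have N0 : (0 < N)%N by rewrite muln_gt0 expn_gt0 fact_gt0.
have -> : (((1 - scale_avg j) ^+ k * h) (grid_vec u + grid_vec w)
       - ((1 - scale_avg j) ^+ k * h) (grid_vec u))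
     - (h (grid_vec u + grid_vec w) - h (grid_vec u)) =
   (scale_rem j * (box_avg R grid_gen 1 N * (1 - transl R (grid_vec w))) * grid_ind a)
     (grid_vec u).
  have -> : scale_rem j * (box_avg R grid_gen 1 N * (1 - transl R (grid_vec w))) * grid_ind a =
     scale_rem j * scale_avg j * h - transl R (grid_vec w) * (scale_rem j * scale_avg j * h).
    by rewrite /h -scale_avg_fine_avg //; ring.
  rewrite scale_remE [scale_avg j * _]mulrC group_alg_subE translM.
  have E v : ((1 - scale_rem j * scale_avg j) * h) v = h v - (scale_rem j * scale_avg j * h) v.
    by rewrite mulrBl mul1r group_alg_subE.
  by rewrite !E; ring.
apply: le_trans (conv_bound _ _ (grid_ind_bound a)) _; rewrite mulr1.
apply: le_trans (l1M _ _) _; rewrite ler_pM ?l1_ge0 ?scale_rem_l1 //.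
apply: le_trans (box_avg_lipschitz N0 wc) _; rewrite -mulrA ler_wpM2l //.
have -> : U = (N * 2 ^ j)%N by rewrite /N mulnAC -expnD subnK // mulnC.
rewrite natrM natrX invfM mulrA mulrC mulrA mulVf ?mul1r //.
Qed.

Definition plane_pos (u : 'I_m -> nat) (z : 'I_k -> 'I_m -> nat)
    (a : {ffun 'I_k -> 'I_n}) (l : 'I_m) : nat :=
  (u l + \sum_(i < k) z i l * a i)%N.

(** This is T P f at the plane with base [u] and parameters [z], where f is first averaged over
    cubes of side [L]. *)
Definition plane_mean (P : group_alg R V) u z : R :=
  (n%:R ^+ k)^-1 * \sum_a (P * (fine_avg * grid_ind a)) (grid_vec (plane_pos u z a)).

Lemma dirs_gt0 : 0 < n%:R ^+ k :> R.
Proof. by rewrite exprn_gt0 // ltr0n n_gt0. Qed.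

Lemma mean_const (c : R) : (n%:R ^+ k)^-1 * \sum_(a : {ffun 'I_k -> 'I_n}) c = c.
Proof.
rewrite sumr_const card_ffun !card_ord -[c *+ _]mulr_natl natrX mulrA mulVf ?mul1r //.
by rewrite gt_eqF // dirs_gt0.
Qed.

Lemma eq_plane_mean P u u' z z' : u =1 u' -> z =2 z' -> plane_mean P u z = plane_mean P u' z'.
Proof.
move=> uu zz; congr (_ * _); apply: eq_bigr => a _; congr (_ _); apply: eq_grid_vec => l.
by rewrite /plane_pos uu; congr (_ + _)%N; apply: eq_bigr => i _; rewrite zz.
Qed.

Lemma plane_mean_sum P u (t : T) :
  plane_mean P u (fun i l => t i l) = (n%:R ^+ k)^-1 * plane_sum P t (grid_vec u).
Proof.
congr (_ * _); rewrite /plane_sum /slice_sum sum_ffunE; apply: eq_bigr => a _.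
rewrite translM; congr (_ _); under eq_bigr do rewrite box_point_vec grid_vecMn.
by rewrite grid_vec_sum grid_vecD.
Qed.

(* All grid points met by [fine_avg] on the plane of (u, z) are in [F]. *)
Definition saturated u z := forall a (s : 'I_m -> nat),
  (forall l, plane_pos u z a l <= s l < plane_pos u z a l + L)%N -> F a s.

Lemma plane_pos_le u z a l : (forall l, u l < (2 * K + 1) * U)%N -> (forall i l, z i l < Z)%N ->
  (plane_pos u z a l + L <= M)%N.
Proof.
move=> uU zZ.
have S : (\sum_(i < k) z i l * a i <= k * ((2 * K + 1) * U))%N.
  apply: (@leq_trans (\sum_(i < k) (2 * K + 1) * U)%N); last by rewrite sum_nat_const card_ord.
  apply: leq_sum => i _; rewrite -nD mulnCA [leqLHS]mulnC; apply: leq_mul.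
    exact: ltnW (ltn_ord _).
  exact: ltnW (zZ _ _).
have LU : (L <= U)%N by rewrite leq_pmulr ?expn_gt0.
have := uU l; move: S LU; rewrite /plane_pos /M;
  move: (\sum_(i < k) _)%N (u l) U L => s v U' L'; nia.
Qed.

(** On a saturated plane T f = 1. At scale 0 the averages run over unit cubes, so they are bounded
    by the normalized mass of each fibre, and their mean over the fibres is at most eta. The
    cofactor [scale_rem 0] costs 2^k. *)
Lemma saturated_ge u z : (forall l, u l < (2 * K + 1) * U)%N -> (forall i l, z i l < Z)%N ->
  saturated u z -> 2^-1 <= plane_mean ((1 - scale_avg 0) ^+ k) u z.
Proof.
move=> uU zZ gu.
have h1 a : (fine_avg * grid_ind a) (grid_vec (plane_pos u z a)) = 1.
  apply: box_avg_const => [|t]; first exact: fact_gt0.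
  rewrite ffunE box_point_vec grid_vecD gu // => l; rewrite grid_vecE; last first.
    by apply: leq_trans (plane_pos_le a l uU zZ); rewrite leq_add2l ltnW.
  by rewrite leq_addr ltn_add2l ltn_ord.
have hU : (2 ^ (J - 0) * L = U)%N by rewrite subn0 mulnC.
have UM : (U <= M.+1)%N by apply: leqW; rewrite /M; move: U; nia.
have h2 a : 1 - 2 ^+ k * ((U%:R^-1) ^+ m * l1 (grid_ind a)) <=
    ((1 - scale_avg 0) ^+ k * (fine_avg * grid_ind a)) (grid_vec (plane_pos u z a)).
  rewrite scale_remE mulrBl mul1r group_alg_subE h1 lerD2l lerN2.
  have -> : scale_avg 0 * scale_rem 0 * (fine_avg * grid_ind a)
    = scale_rem 0 * (box_avg R grid_gen 1 U * grid_ind a).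
    by rewrite -hU -scale_avg_fine_avg //; ring.
  apply: le_trans (ler_norm _) _; apply: le_trans (conv_bound _ _ (fun v => box_avg_sup _ _ UM)) _.
  by rewrite ler_wpM2r ?scale_rem_l1 // mulr_ge0 ?l1_ge0 ?exprn_ge0 ?invr_ge0.
apply: (@le_trans _ _ ((n%:R ^+ k)^-1 * \sum_a (1 - 2 ^+ k * ((U%:R^-1) ^+ m * l1 (grid_ind a))))); last first.
  by rewrite ler_wpM2l ?invr_ge0 ?(ltW dirs_gt0) //; apply: ler_sum => a _; apply: h2.
rewrite big_split /= mulrDr mean_const sumrN -!mulr_sumr mulrN.
suff : (n%:R ^+ k)^-1 * (2 ^+ k * (U%:R^-1 ^+ m * \sum_a l1 (grid_ind a)))
  <= 2 ^+ k * eta by move: eta_small; lra.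
rewrite mulrCA ler_wpM2l ?exprn_ge0 //.
apply: (@le_trans _ _ ((n%:R ^+ k)^-1 * (U%:R^-1 ^+ m * (eta * n%:R ^+ k * U%:R ^+ m)))).
  by rewrite ler_wpM2l ?invr_ge0 ?(ltW dirs_gt0) // ler_wpM2l ?exprn_ge0 ?invr_ge0.
rewrite le_eqVlt; apply/orP; left; apply/eqP; rewrite exprVn.
have U0 : U%:R ^+ m != 0 :> R by rewrite expf_neq0 // pnatr_eq0 -lt0n U_gt0.
by field; rewrite U0 gt_eqF // dirs_gt0.
Qed.

Definition scale_inc j : group_alg R V := (1 - scale_avg j) ^+ k - (1 - scale_avg j.+1) ^+ k.

Lemma plane_meanB P Q u z : plane_mean (P - Q) u z = plane_mean P u z - plane_mean Q u z.
Proof.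
rewrite /plane_mean -mulrBr -sumrB; congr (_ * _); apply: eq_bigr => a _.
by rewrite mulrBl group_alg_subE.
Qed.

Lemma saturated_pigeonhole u z : (forall l, u l < (2 * K + 1) * U)%N ->
  (forall i l, z i l < Z)%N ->
  saturated u z -> exists2 j, (j < J)%N & threshold R j <= `|plane_mean (scale_inc j) u z|.
Proof.
move=> uU zZ gu.
(* At the finest scale each average has a single point, so 1 - A_J = 0, and its k-th power vanishes
   because k > 0. *)
have PJ : plane_mean ((1 - scale_avg J) ^+ k) u z = 0.
  by rewrite scale_avgJ subrr expr0n gtn_eqF // /plane_mean big1 ?mulr0 // => a _;
    rewrite mul0r ffunE.
have [j jJ cj_le] :=
  @threshold_pigeonhole R (fun j => plane_mean ((1 - scale_avg j) ^+ k) u z) J PJ (saturated_ge uU zZ gu).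
by exists j => //; rewrite plane_meanB.
Qed.

(* A cell of level j has side 1 / cell_res j.  Since cell_res j < n, it divides (n-1)!,
   so cells consist of full blocks of grid points.  The constant keeps the variation of
   the mean at level j below a quarter of the threshold on each cell. *)
Definition cell_res j := (2 ^ k * 256 * m * (k + 1) * 2 ^ j * (j.+1 ^ 2))%N.
Hypothesis cell_res_lt : forall j, (j < J)%N -> (cell_res j < n)%N.
Hypothesis J_nu : (J <= nu)%N.

(** Sides of a cell of level j, counted in steps 1/D for the parameters y_i with i >= 1 and in steps
    1/U for the base y_0. *)
Definition cell_dir j := (D %/ cell_res j)%N.
Definition cell_base j := (n * cell_dir j)%N.

Lemma cell_res_gt0 j : (0 < cell_res j)%N.
Proof. by rewrite /cell_res !muln_gt0 !expn_gt0 m0 addn1. Qed.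

Lemma cell_dirE j : (j < J)%N -> (cell_dir j * cell_res j = D)%N.
Proof.
move=> jJ; rewrite divnK // dvdn_mulr // dvdn_fact // cell_res_gt0 /=.
by rewrite -ltnS prednK ?n_gt0 // cell_res_lt.
Qed.

Lemma cell_baseE j : (j < J)%N -> (cell_base j * cell_res j = U)%N.
Proof. by move=> jJ; rewrite -mulnA cell_dirE // nD. Qed.

Lemma cell_dir_gt0 j : (j < J)%N -> (0 < cell_dir j)%N.
Proof. by move=> jJ; have := D_gt0; rewrite -(cell_dirE jJ) muln_gt0 => /andP[]. Qed.

Lemma cell_base_gt0 j : (j < J)%N -> (0 < cell_base j)%N.
Proof. by move=> jJ; rewrite muln_gt0 n_gt0 cell_dir_gt0. Qed.

Lemma plane_mean_lipschitz j u z du dz : (j < J)%N -> (forall l, du l <= cell_base j)%N ->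
  (forall i l, dz i l <= cell_dir j)%N ->
  `|plane_mean (scale_inc j) (fun l => u l + du l)%N (fun i l => z i l + dz i l)%N
    - plane_mean (scale_inc j) u z| <= threshold R j / 4.
Proof.
move=> jJ duU dzD.
have E a : grid_vec (plane_pos (fun l => u l + du l)%N (fun i l => z i l + dz i l)%N a) =
    grid_vec (plane_pos u z a) + grid_vec (plane_pos du dz a).
  rewrite grid_vecD; apply: eq_grid_vec => l; rewrite /plane_pos.
  by under eq_bigr do rewrite mulnDl; rewrite big_split /= addnACA.
(* A parameter step of at most [cell_dir j] is multiplied by a i < n, so it moves the point by at
   most [cell_base j]; there are k of these, and the base itself. *)
have wle a l : (plane_pos du dz a l <= (k + 1) * cell_base j)%N.
  rewrite /plane_pos mulnDl mul1n addnC leq_add //.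
  rewrite -[k in leqRHS]card_ord -sum_nat_const leq_sum // => i _.
  by rewrite mulnC leq_mul // ltnW.
(* The left side equals 6 / (256 (j + 1)^2); as j + 2 <= 2 (j + 1), it is at most 1 / (16 (j + 1) (j
   + 2)). *)
have cU : 2 ^+ k * ((2 * m * ((k + 1) * cell_base j))%:R * 2 ^+ j / U%:R) +
    2 ^+ k * ((2 * m * ((k + 1) * cell_base j))%:R * 2 ^+ j.+1 / U%:R) <= threshold R j / 4.
  rewrite -mulrDr -mulrDl -mulrDr -(cell_baseE jJ) /threshold /cell_res.
  have -> : 2 ^+ j + 2 ^+ j.+1 = (3 * 2 ^ j)%:R :> R by rewrite exprS natrM natrX; ring.
  have dU0 : (cell_base j)%:R != 0 :> R by rewrite pnatr_eq0 -lt0n cell_base_gt0.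
  have -> : 2 ^+ k * ((2 * m * ((k + 1) * cell_base j))%:R * (3 * 2 ^ j)%:R /
     (cell_base j * (2 ^ k * 256 * m * (k + 1) * 2 ^ j * j.+1 ^ 2))%:R)
       = 6 / (256 * j.+1 ^ 2)%:R :> R.
    move: (cell_base j) dU0 => d d0; rewrite !natrM !natrX; field.
    by rewrite d0 [1 + _]addrC !natr1 !expf_eq0 !pnatr_eq0 -!lt0n m0 !andbF.
  rewrite -[leRHS]invfM -natrM.
  have p16 : (0 < 4 * j.+1 * j.+2 * 4)%N by rewrite !muln_gt0.
  rewrite ler_pdivrMr ?ltr0n ?muln_gt0 // mulrC ler_pdivlMr ?ltr0n //.
  rewrite -natrM ler_nat; nia.
rewrite -mulrBr -sumrB normrM ger0_norm ?invr_ge0 ?(ltW dirs_gt0) //.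
rewrite -[leRHS]mean_const ler_wpM2l ?invr_ge0 ?(ltW dirs_gt0) //.
apply: le_trans (ler_norm_sum _ _ _) _; apply: ler_sum => a _; apply: le_trans cU.
have l1' := @scale_diff_lipschitz j a (plane_pos u z a) (plane_pos du dz a) _ (ltnW jJ) (wle a).
have l2' := @scale_diff_lipschitz j.+1 a (plane_pos u z a) (plane_pos du dz a) _ jJ (wle a).
by rewrite E /scale_inc mulrBl !group_alg_subE; apply: norm_diff4 l1' l2'.
Qed.

(** * Heavy cells and their number *)

Definition cell_index j := {ffun 'I_k.+1 * 'I_m -> 'I_((2 * K + 1) * cell_res j)}.
Definition cell_base_pt j (c : cell_index j)
    (r : {ffun 'I_m -> 'I_(cell_base j)}) (l : 'I_m) : nat :=
  (c (ord0, l) * cell_base j + r l)%N.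
Definition cell_dir_pt j (c : cell_index j)
    (r : {ffun 'I_k -> {ffun 'I_m -> 'I_(cell_dir j)}}) (i : 'I_k) (l : 'I_m) : nat :=
  (c (lift ord0 i, l) * cell_dir j + r i l)%N.
Definition heavy j (c : cell_index j) :=
  [exists r0, [exists r1, threshold R j
  <= `|plane_mean (scale_inc j) (cell_base_pt c r0) (cell_dir_pt c r1)|]].

Lemma cell_lt (a b d r : nat) : (a < b)%N -> (r < d)%N -> (a * d + r < b * d)%N.
Proof.
move=> ab rd; apply: (@leq_trans (a.+1 * d)); last by rewrite leq_mul2r ab orbT.
by rewrite mulSnr ltn_add2l.
Qed.

Lemma cell_base_pt_lt j (c : cell_index j) r l : (j < J)%N ->
  (cell_base_pt c r l < (2 * K + 1) * U)%N.
Proof.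
move=> jJ; rewrite -(cell_baseE jJ) [(cell_base j * _)%N]mulnC mulnA; exact: cell_lt.
Qed.

Lemma cell_dir_pt_lt j (c : cell_index j) r i l : (j < J)%N -> (cell_dir_pt c r i l < Z)%N.
Proof.
move=> jJ; rewrite /Z -(cell_dirE jJ) [(cell_dir j * _)%N]mulnC mulnA; exact: cell_lt.
Qed.

(** The witness and the given point both differ from the corner of the cell by at most a quarter of
    the threshold. *)
Lemma heavy_all j (c : cell_index j) r0 r1 : (j < J)%N -> heavy c ->
  threshold R j / 2 <= `|plane_mean (scale_inc j) (cell_base_pt c r0) (cell_dir_pt c r1)|.
Proof.
move=> jJ /existsP[s0 /existsP[s1 cs]].
pose w := plane_mean (scale_inc j) (fun l => c (ord0, l) * cell_base j)%N
  (fun i l => c (lift ord0 i, l) * cell_dir j)%N.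
have H (r : {ffun 'I_m -> 'I_(cell_base j)}) (r' : {ffun 'I_k -> {ffun 'I_m -> 'I_(cell_dir j)}}) :
    `|plane_mean (scale_inc j) (cell_base_pt c r) (cell_dir_pt c r') - w| <= threshold R j / 4.
  by apply: plane_mean_lipschitz => // [l|i l]; apply: ltnW.
have /ler_normlP[h1 h2] := H r0 r1; have /ler_normlP[h3 h4] := H s0 s1.
move: cs h1 h2 h3 h4.
move: (plane_mean _ (cell_base_pt c r0) _) (plane_mean _ (cell_base_pt c s0) _) (threshold R j) => x y q.
by rewrite ler_normr => /orP[] ? *; rewrite ler_normr; apply/orP; [left|right]; lra.
Qed.

Lemma eta_ge0 : 0 <= eta.
Proof.
have : 0 <= eta * n%:R ^+ k * U%:R ^+ m.
  by apply: le_trans F_mass; apply: sumr_ge0 => a _; apply: l1_ge0.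
by rewrite !pmulr_lge0 ?dirs_gt0 // exprn_gt0 // ltr0n U_gt0.
Qed.

Lemma scale_inc_l2 j : (j < J)%N ->
  \sum_(t : T) \sum_v (plane_sum (scale_inc j) t v) ^+ 2
  <= 4 * ((8 * m)%:R ^+ k * Z%:R ^+ (m * k) * (n%:R ^+ k) ^+ 2 * U%:R ^+ m * eta
     * (j.+2%:R / 2 ^+ j) ^+ k).
Proof.
move=> jJ; set Q := _ * eta.
have sum_ge0 j' : 0 <= \sum_(t : T) \sum_v (plane_sum ((1 - scale_avg j') ^+ k) t v) ^+ 2.
  by apply: sumr_ge0 => t _; apply: sumr_ge0 => v _; exact: sqr_ge0.
have Q0 : 0 <= Q by rewrite /Q !mulr_ge0 ?exprn_ge0 // eta_ge0.
have S1 := plane_sum_l2 (ltnW jJ) (leq_trans (ltnW jJ) J_nu).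
have S2 := plane_sum_l2 jJ (leq_trans jJ J_nu).
rewrite -/Q in S1 S2.
have TTB P P' t v : (plane_sum (P - P') t v) = plane_sum P t v - plane_sum P' t v.
  rewrite /plane_sum /slice_sum !sum_ffunE -sumrB; apply: eq_bigr => a _.
  by rewrite mulrBl mulrBr group_alg_subE.
have E1 : (j.+1%:R / 2 ^+ j) ^+ k <= (j.+2%:R / 2 ^+ j) ^+ k :> R.
  by rewrite lerXn2r ?nnegrE ?divr_ge0 ?exprn_ge0 // ler_wpM2r ?invr_ge0 ?exprn_ge0 // ler_nat.
have E2 : (j.+2%:R / 2 ^+ j.+1) ^+ k <= (j.+2%:R / 2 ^+ j) ^+ k :> R.
  rewrite lerXn2r ?nnegrE ?divr_ge0 ?exprn_ge0 // ler_wpM2l //.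
  rewrite lef_pV2 ?posrE ?exprn_gt0 // exprS ler_peMl ?exprn_ge0 //.
  by rewrite ler1n.
under eq_bigr do under eq_bigr do rewrite TTB.
exact: sum_sqrB_le (le_trans S1 (ler_wpM2l Q0 E1)) (le_trans S2 (ler_wpM2l Q0 E2)).
Qed.

(** Chebyshev's inequality: every grid point of a heavy cell contributes at least (n^k threshold /
    2)^2 to the square sum of [scale_inc_l2]. In the exponent k + 4 of j + 2, k comes from that sum
    and 4 from the squared threshold. *)
Lemma heavy_count j : (j < J)%N ->
  #|[pred c : cell_index j | heavy c]|%:R <=
  (256 * (8 * m) ^ k * (2 * K + 1) ^ (m * k))%:R * eta * (cell_res j)%:R ^+ (m + m * k)
    * ((j.+2)%:R ^+ (k + 4) / (2 ^+ j) ^+ k).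
Proof.
move=> jJ.
pose I := ({ffun 'I_m -> 'I_(cell_base j)} * {ffun 'I_k -> {ffun 'I_m -> 'I_(cell_dir j)}})%type.
pose tz (x : cell_index j * I) : T :=
  [ffun i => [ffun l => Ordinal (cell_dir_pt_lt x.1 x.2.2 i l jJ)]].
pose h (x : cell_index j * I) : T * V := (tz x, grid_vec (cell_base_pt x.1 x.2.1)).
have divE a b d r s : (r < d)%N -> (s < d)%N -> (a * d + r = b * d + s -> a = b /\ r = s)%N.
  move=> rd sd e; have d0 : (0 < d)%N by apply: leq_trans rd.
  have := congr1 (divn^~ d) e; rewrite /= !divnMDl // !divn_small // !addn0 => ab.
  by split=> //; move: e; rewrite ab => /addnI.
(* Division with remainder recovers the cell and the position in it; base coordinates stay below M,
   so the torus identifies none of them. *)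
have hinj : injective h.
  move=> [c [r0 r1]] [c' [s0 s1]] [/ffunP tE /rowP vE].
  have E0 l : c (ord0, l) = c' (ord0, l) /\ r0 l = s0 l.
    have := congr1 (@nat_of_ord _) (vE l); rewrite !grid_vecE /=.
    - by case/divE => [||/val_inj ? /val_inj].
    - have := cell_base_pt_lt c' s0 l jJ; rewrite /M; move: U (cell_base_pt _ _ _) => U' x; nia.
    - have := cell_base_pt_lt c r0 l jJ; rewrite /M; move: U (cell_base_pt _ _ _) => U' x; nia.
  have E1 i l : c (lift ord0 i, l) = c' (lift ord0 i, l) /\ r1 i l = s1 i l.
    have := congr1 (fun F : {ffun 'I_m -> 'I_Z} => (F l : nat)) (tE i); rewrite !ffunE /=.
    by case/divE => [||/val_inj ? /val_inj].
  congr (_, (_, _)).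
  - by apply/ffunP => -[i l]; case: (unliftP ord0 i) => [i' ->|->];
    [case: (E1 i' l)|case: (E0 l)].
  - by apply/ffunP => l; case: (E0 l).
  - by apply/ffunP => i; apply/ffunP => l; case: (E1 i l).
have := sum_inj_le hinj (fun x : T * V => sqr_ge0 (plane_sum (scale_inc j) x.1 x.2)).
rewrite -(pair_bigA _ (fun t v => plane_sum (scale_inc j) t v ^+ 2)) /= =>
  /le_trans/(_ (scale_inc_l2 jJ)) H.
have nk0 := dirs_gt0.
have HE : #|[pred c : cell_index j | heavy c]|%:R
    * ((cell_base j)%:R ^+ m * (cell_dir j)%:R ^+ (m * k) * ((n%:R ^+ k) ^+ 2 * (threshold R j / 2) ^+ 2))
   <= \sum_x (plane_sum (scale_inc j) (h x).1 (h x).2) ^+ 2.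
  rewrite -(pair_bigA _ (fun c r => plane_sum (scale_inc j) (h (c, r)).1 (h (c, r)).2 ^+ 2)) /=.
  apply: (@le_trans _ _ (\sum_(c | heavy c) \sum_(r : I)
    (plane_sum (scale_inc j) (h (c, r)).1 (h (c, r)).2) ^+ 2)); last first.
    rewrite [leRHS](bigID (@heavy j)) /= lerDl; apply: sumr_ge0 => c _.
    by apply: sumr_ge0 => r _; exact: sqr_ge0.
  rewrite mulr_natl -sumr_const; apply: ler_sum => c cbad.
  have -> : (cell_base j)%:R ^+ m * (cell_dir j)%:R ^+ (m * k) = #|{: I}|%:R :> R.
    by rewrite card_prod !card_ffun !card_ord natrM natrX natrX natrX exprM.
  rewrite mulr_natl -sumr_const; apply: ler_sum => -[r0 r1] _ /=.
  have -> : plane_sum (scale_inc j) (tz (c, (r0, r1))) (grid_vec (cell_base_pt c r0))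
    = n%:R ^+ k * plane_mean (scale_inc j) (cell_base_pt c r0) (cell_dir_pt c r1).
    rewrite -(@eq_plane_mean _ (cell_base_pt c r0) _ (fun i l => tz (c, (r0, r1)) i l)) //;
      last by move=> i l; rewrite !ffunE.
    by rewrite plane_mean_sum mulrA divff ?mul1r // gt_eqF.
  rewrite [leRHS]exprMn ler_wpM2l ?sqr_ge0 // -[leRHS]real_normK ?num_real //.
  by rewrite lerXn2r ?nnegrE ?divr_ge0 ?invr_ge0 // heavy_all.
have {HE H} := le_trans HE H.
rewrite -(cell_baseE jJ) /Z -(cell_dirE jJ);
  move: (cell_base_gt0 jJ) (cell_dir_gt0 jJ) (cell_res_gt0 j).
move: (cell_base j) (cell_dir j) (cell_res j) #|_| => u d l N u0 d0 l0.
(* Half the threshold is 1 / (8 (j + 1) (j + 2)), at least 1 / (8 (j + 2)^2). *)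
have c1 : 1 <= 64 * j.+2%:R ^+ 4 * (threshold R j / 2) ^+ 2.
  rewrite /threshold -invfM -natrM exprVn -natrX -[64]/(64%:R) -natrX -natrM.
  rewrite ler_pdivlMr ?ltr0n ?expn_gt0 ?muln_gt0 //.
  rewrite mul1r ler_nat; apply: (@leq_trans ((8 * (j.+2 * j.+2)) ^ 2)%N).
    by rewrite leq_exp2r //; nia.
  by rewrite expnMn -expnMn; lia.
set x := u%:R ^+ m * d%:R ^+ (m * k) * ((n%:R ^+ k) ^+ 2 * (threshold R j / 2) ^+ 2).
have x0 : 0 < x.
  have cj0 : 0 < threshold R j / 2 by rewrite divr_gt0 // invr_gt0 ltr0n !muln_gt0.
  by rewrite /x; apply: mulr_gt0; apply: mulr_gt0; apply: exprn_gt0; rewrite ?dirs_gt0 ?ltr0n.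
move=> H; rewrite -(ler_pM2r x0); apply: le_trans H _.
set Q := (8 * m)%:R ^+ k * ((2 * K + 1) * (d * l))%:R ^+ (m * k) * (n%:R ^+ k) ^+ 2
  * (u * l)%:R ^+ m * eta
  * (j.+2%:R / 2 ^+ j) ^+ k.
have Q0 : 0 <= Q by rewrite /Q !mulr_ge0 ?exprn_ge0 ?divr_ge0 ?exprn_ge0 // eta_ge0.
apply: (@le_trans _ _ (4 * Q * (64 * j.+2%:R ^+ 4 * (threshold R j / 2) ^+ 2))).
  by rewrite ler_peMr // mulr_ge0.
rewrite le_eqVlt; apply/orP; left; apply/eqP;
  rewrite /Q /x !natrM !natrX natrM !exprMn !exprVn !exprD.
by field; rewrite [1 + _]addrC natr1 -natrD !pnatr_eq0 !expf_neq0 ?pnatr_eq0.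
Qed.

Lemma saturated_heavy u z : (forall l, u l < (2 * K + 1) * U)%N -> (forall i l, z i l < Z)%N ->
  saturated u z -> exists2 j, (j < J)%N & exists c : cell_index j,
    [/\ heavy c, forall l, u l %/ cell_base j = c (ord0, l)
      & forall i l, z i l %/ cell_dir j = c (lift ord0 i, l)]%N.
Proof.
move=> uU zZ gu; have [j jJ cle] := saturated_pigeonhole uU zZ gu; exists j => //.
(* Quotients by the cell sides name the cell; the remainders are the witnesses of heaviness. *)
pose q (x : 'I_k.+1 * 'I_m) :=
  if unlift ord0 x.1 is Some i then (z i x.2 %/ cell_dir j)%N else (u x.2 %/ cell_base j)%N.
have qlt x : (q x < (2 * K + 1) * cell_res j)%N.
  rewrite /q; case: unliftP => [i _|_].
    by rewrite ltn_divLR ?cell_dir_gt0 // -mulnA [(cell_res j * _)%N]mulnC cell_dirE.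
  by rewrite ltn_divLR ?cell_base_gt0 // -mulnA [(cell_res j * _)%N]mulnC cell_baseE.
pose c : cell_index j := [ffun x => Ordinal (qlt x)].
have c0 l : c (ord0, l) = (u l %/ cell_base j)%N :> nat by rewrite ffunE /= /q unlift_none.
have cS i l : c (lift ord0 i, l) = (z i l %/ cell_dir j)%N :> nat by rewrite ffunE /= /q liftK.
clearbody c; exists c; split=> //; apply/existsP.
exists [ffun l => Ordinal (ltn_pmod (u l) (cell_base_gt0 jJ))]; apply/existsP.
exists [ffun i => [ffun l => Ordinal (ltn_pmod (z i l) (cell_dir_gt0 jJ))]].
rewrite -(@eq_plane_mean _ u _ z) // => [l|i l]; rewrite /cell_base_pt /cell_dir_pt !ffunE.
  by rewrite c0 /= -divn_eq.
by rewrite cS /= -divn_eq.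
Qed.

End Grid.

(** * From the grid to real planes *)

Lemma count_progression (R : realFieldType) (lo hi o : R) (N M : nat) : (0 < N)%N -> lo <= hi ->
  \sum_(s < M) (((lo <= o + s%:R / N%:R <= hi)%R : bool) : nat)%:R <= (hi - lo) * N%:R + 1.
Proof.
move=> N0 lohi; have N0' : 0 < N%:R :> R by rewrite ltr0n.
set f : nat -> R := fun s => (((lo <= o + s%:R / N%:R <= hi)%R : bool) : nat)%:R.
(* The second bound counts the points to the right of [lo] among the first M and carries the
   induction: if the next point is still at most [hi], the count so far is at most (hi - lo) N. *)
suff [] : \sum_(s < M) f s <= (hi - lo) * N%:R + 1 /\
   \sum_(s < M) f s <= Num.max 0 ((o - lo) * N%:R + M%:R) by [].
elim: M => [|M [IH1 IH2]].
  rewrite big_ord0; split; last by rewrite le_max lexx.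
  by rewrite addr_ge0 // mulr_ge0 ?subr_ge0.
rewrite big_ord_recr /= [f M]/f; have [/andP[loM Mhi]|_] := boolP (lo <= o + M%:R / N%:R <= hi).
  have E : (o - lo) * N%:R + M%:R = (o - lo + M%:R / N%:R) * N%:R.
    by rewrite [RHS]mulrDl divfK // gt_eqF.
  have h1 : (o - lo) * N%:R + M%:R >= 0 by rewrite E mulr_ge0 //; lra.
  have h2 : (o - lo) * N%:R + M%:R <= (hi - lo) * N%:R by rewrite E ler_wpM2r //; lra.
  move: IH2; rewrite (max_idPr h1) -natr1 mulr1n.
  move: (\sum_(s < M) f s) h2 => x h2 IH2; split; first by lra.
  by rewrite le_max; apply/orP; right; lra.
rewrite addr0; split=> //; apply: le_trans IH2 _.
by rewrite ge_max !le_max lexx /= -natr1 addrA lerDl ler01 orbT.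
Qed.

Definition cbox (R : realType) (d : nat) (p : 'rV[R]_d) (ab : 'rV[R]_d * 'rV[R]_d) : bool :=
  [forall c, ab.1 0 c <= p 0 c <= ab.2 0 c].

Section DiscreteCover.
Variables (R : realType) (m k K : nat).
Hypotheses (m0 : (0 < m)%N) (k0 : (0 < k)%N).

Definition plane_val (y : 'M[R]_(k.+1, m)) (x : 'rV[R]_k) : 'rV[R]_m :=
  \row_l (y ord0 l + \sum_(i < k) x 0 i * y (lift ord0 i) l).

Section Scale.
Variables (nu J : nat) (B : seq ('rV[R]_(k + m) * 'rV[R]_(k + m))).
Let n := (2 ^ nu)%N.
Let U := (n`! * 2 ^ J)%N.

Definition grid_x (a : {ffun 'I_k -> 'I_n}) : 'rV[R]_k := \row_i ((a i)%:R / n%:R).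
(* The fibre coordinate, over the point [grid_x a], of the plane of the lowest grid
   parameters, all equal to -K. *)
Definition grid_origin (a : {ffun 'I_k -> 'I_n}) : R := - K%:R * (1 + \sum_i ((a i)%:R / n%:R)).
Definition grid_u (a : {ffun 'I_k -> 'I_n}) (s : 'I_m -> nat) : 'rV[R]_m :=
  \row_l (grid_origin a + (s l)%:R / U%:R).
Definition grid_F (a : {ffun 'I_k -> 'I_n}) (s : 'I_m -> nat) : bool :=
  has (cbox (row_mx (grid_x a) (grid_u a s))) B.

Lemma sum_prod_rV (M : nat) (G : 'I_m -> 'I_M.+1 -> R) :
  \sum_(v : 'rV['I_M.+1]_m) \prod_l G l (v 0 l) = \prod_l \sum_s G l s.
Proof.
rewrite bigA_distr_bigA /= (reindex (fun f : {ffun 'I_m -> 'I_M.+1} => \row_l f l)) /=.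
  by apply: eq_bigr => f _; apply: eq_bigr => l _; rewrite mxE.
exists (fun v : 'rV_m => [ffun l => v 0 l]) => [f _|v _].
  by apply/ffunP => l; rewrite ffunE mxE.
by apply/rowP => l; rewrite mxE ffunE.
Qed.

Lemma cbox_prod (d : nat) (p : 'rV[R]_d) ab :
  (cbox p ab : nat)%:R = \prod_c (((ab.1 0 c <= p 0 c <= ab.2 0 c)%R : bool) : nat)%:R :> R.
Proof.
rewrite /cbox; case: (boolP [forall c, _]) => [/forallP h|/forallPn[c /negPf h]].
  by rewrite big1 // => c _; rewrite h.
by rewrite (bigD1 c) //= h mul0r.
Qed.

(** In each coordinate a box meets at most side n + 1 or side U + 1 grid values, and delta >= 1/n,
    1/U absorbs the 1. The fibre grid shifts with [a], but the count does not depend on the shift,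
    so the sum factors. *)
Lemma grid_F_small (delta eta : R) : 0 < delta -> n%:R^-1 <= delta ->
  (forall b, b \in B -> forall c, b.1 0 c <= b.2 0 c) ->
  \sum_(b <- B) \prod_c (b.2 0 c - b.1 0 c + delta) <= eta ->
  \sum_a l1 (grid_ind R K J grid_F a) <= eta * n%:R ^+ k * U%:R ^+ m.
Proof.
move=> delta0 ndelta Ble Beta.
have n0 : (0 < n)%N by rewrite expn_gt0.
have U0 : (0 < U)%N by rewrite muln_gt0 fact_gt0 expn_gt0.
have nn0 : 0 < n%:R :> R by rewrite ltr0n.
have UU0 : 0 < U%:R :> R by rewrite ltr0n.
have Udelta : U%:R^-1 <= delta.
  apply: le_trans ndelta; rewrite lef_pV2 ?posrE // ler_nat.
  by apply: leq_trans (leq_pmulr _ _);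
    rewrite ?expn_gt0 // -{1}(prednK n0) -(prednK n0) factS leq_pmulr ?fact_gt0.
apply: (@le_trans _ _ (\sum_(b <- B) \prod_c (b.2 0 c - b.1 0 c + delta) * n%:R ^+ k * U%:R ^+ m)); last first.
  by rewrite -!mulr_suml !ler_wpM2r ?exprn_ge0.
pose Q a b (v : 'rV['I_((k + 1) * (2 * K + 3) * U).+1]_m) : R :=
  (cbox (row_mx (grid_x a) (grid_u a (fun l => v 0 l))) b : nat)%:R.
apply: (@le_trans _ _ (\sum_a \sum_v \sum_(b <- B) Q a b v)).
  apply: ler_sum => a _; apply: ler_sum => v _; rewrite ffunE /grid_F.
  elim: B => [|b B' IH] /=; first by rewrite big_nil normr0.
  rewrite big_cons; apply: le_trans (lerD (lexx _) IH).
  rewrite /Q; case: (cbox _ b) => /=; last by rewrite add0r.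
  by rewrite normr1 lerDl.
rewrite exchange_big /= [leLHS](_ : _ = \sum_(b <- B) \sum_a \sum_v Q a b v); last first.
  by rewrite exchange_big; under eq_bigr do rewrite exchange_big; rewrite exchange_big.
rewrite big_seq [leRHS]big_seq; apply: ler_sum => b bB; have bl := Ble b bB.
rewrite big_split_ord /=.
pose X i : R := b.2 0 (lshift m i) - b.1 0 (lshift m i) + delta.
pose Y l : R := b.2 0 (rshift k l) - b.1 0 (rshift k l) + delta.
pose gx (i : 'I_k) (t : 'I_n) : R :=
  (((b.1 0 (lshift m i) <= 0 + t%:R / n%:R <= b.2 0 (lshift m i))%R : bool) : nat)%:R.
pose gu a (l : 'I_m) (t : 'I_((k + 1) * (2 * K + 3) * U).+1) : R :=
  (((b.1 0 (rshift k l) <= grid_origin a + t%:R / U%:R <= b.2 0 (rshift k l))%R : bool) : nat)%:R.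
have QE a (v : 'rV['I_((k + 1) * (2 * K + 3) * U).+1]_m) : Q a b v
  = \prod_i gx i (a i) * \prod_l gu a l (v 0 l).
  rewrite /Q cbox_prod big_split_ord /=; congr (_ * _).
    by apply: eq_bigr => i _; rewrite row_mxEl mxE /gx add0r.
  by apply: eq_bigr => l _; rewrite row_mxEr mxE.
have gx0 i t : 0 <= gx i t by rewrite /gx.
have gu_le a l : \sum_t gu a l t <= Y l * U%:R.
  apply: le_trans (count_progression _ _ U0 (bl _)) _.
  rewrite /Y [leRHS]mulrDl lerD2l -[leLHS](mulVf (lt0r_neq0 UU0)) ler_wpM2r //.
have gx_le i : \sum_t gx i t <= X i * n%:R.
  apply: le_trans (count_progression _ _ n0 (bl _)) _.
  rewrite /X [leRHS]mulrDl lerD2l -[leLHS](mulVf (lt0r_neq0 nn0)) ler_wpM2r //.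
have Qle a : \sum_v Q a b v <= \prod_i gx i (a i) * \prod_l (Y l * U%:R).
  rewrite (eq_bigr _ (fun v _ => QE a v)).
  rewrite -mulr_sumr (sum_prod_rV (gu a)) ler_wpM2l ?prodr_ge0 //.
  by apply: ler_prod => l _; rewrite gu_le andbT sumr_ge0.
apply: (@le_trans _ _ (\sum_(a : {ffun _ -> _}) ((\prod_i gx i (a i)) * \prod_l (Y l * U%:R)))).
  by apply: ler_sum => a _; exact: Qle.
rewrite -mulr_suml -(bigA_distr_bigA gx) /= !big_split /= !prod_const_ord.
have -> : \prod_i X i * \prod_l Y l * n%:R ^+ k * U%:R ^+ m
  = (\prod_i X i * n%:R ^+ k) * (\prod_l Y l * U%:R ^+ m) by ring.
rewrite ler_wpM2r //.
  rewrite mulr_ge0 ?exprn_ge0 // prodr_ge0 // => l _.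
  by rewrite /Y addr_ge0 ?subr_ge0 // ltW.
rewrite -(prod_const_ord k) -big_split /=.
by apply: ler_prod => i _; rewrite gx_le andbT sumr_ge0.
Qed.

(** Rounding the base and the k parameters moves a fibre point by at most 1 + k n units of 1/U, and
    the fine cube adds fewer than n!. Both stay within (k + 2) n! units, which is (k + 2) / 2^J. *)
Lemma grid_saturated (delta : R) (y : 'M[R]_(k.+1, m)) (u : 'I_m -> nat) (z : 'I_k -> 'I_m -> nat) :
  (k + 2)%:R / (2 ^ J)%:R <= delta ->
  (forall l, (u l)%:R / U%:R <= y ord0 l + K%:R <= (u l).+1%:R / U%:R) ->
  (forall i l, (z i l)%:R / (n.-1`! * 2 ^ J)%:R <= y (lift ord0 i) l + K%:R
    <= (z i l).+1%:R / (n.-1`! * 2 ^ J)%:R) ->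
  (forall x : 'rV[R]_k, (forall i, 0 <= x 0 i <= 1) -> forall w : 'rV[R]_m,
     (forall l, `|w 0 l - plane_val y x 0 l| <= delta) -> has (cbox (row_mx x w)) B) ->
  saturated grid_F u z.
Proof.
move=> Jdelta yu yz yB a s sP; apply: yB.
  move=> i; rewrite mxE divr_ge0 //= ler_pdivrMr ?ltr0n ?expn_gt0 // mul1r ler_nat.
  exact: ltnW.
have n0 : (0 < n)%N by rewrite expn_gt0.
have U0 : (0 < U)%N by rewrite muln_gt0 fact_gt0 expn_gt0.
set D := (n.-1`! * 2 ^ J)%N in yz.
have D0 : (0 < D)%N by rewrite muln_gt0 fact_gt0 expn_gt0.
have UD : U%:R = n%:R * D%:R :> R.
  by rewrite -natrM mulnA -{1}(prednK n0) -factS prednK.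
move=> l; apply: le_trans Jdelta; rewrite !mxE.
have UU0 : 0 < U%:R :> R by rewrite ltr0n.
have nn0 : 0 < n%:R :> R by rewrite ltr0n.
have DD0 : 0 < D%:R :> R by rewrite ltr0n.
have key : (u l + \sum_(i < k) z i l * a i)%:R / U%:R
  <= y ord0 l - grid_origin a + \sum_(i < k) grid_x a 0 i * y (lift ord0 i) l
    <= (u l + 1 + \sum_(i < k) (z i l * a i + n))%:R / U%:R.
  have -> : y ord0 l - grid_origin a + \sum_(i < k) grid_x a 0 i * y (lift ord0 i) l =
     (y ord0 l + K%:R) + \sum_(i < k) (a i)%:R / n%:R * (y (lift ord0 i) l + K%:R).
    under [in RHS]eq_bigr do rewrite mulrDr.
    rewrite big_split /= -mulr_suml /grid_origin.
    under [in LHS]eq_bigr do rewrite mxE.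
    by ring.
  rewrite !natrD !mulrDl !natr_sum !mulr_suml -mulrDl natr1.
  have /andP[u1 u2] := yu l.
  apply/andP; split; apply: lerD => //; apply: ler_sum => i _; have /andP[z1 z2] := yz i l.
    have -> : (z i l * a i)%:R / U%:R = (a i)%:R / n%:R * ((z i l)%:R / D%:R) :> R.
      by rewrite UD natrM invfM; ring.
    by rewrite ler_wpM2l // divr_ge0.
  apply: (@le_trans _ _ ((a i)%:R / n%:R * ((z i l).+1%:R / D%:R))).
    by rewrite ler_wpM2l // divr_ge0.
  have -> : (a i)%:R / n%:R * ((z i l).+1%:R / D%:R) = (a i * (z i l).+1)%:R / U%:R :> R.
    by rewrite UD natrM invfM; ring.
  rewrite ler_wpM2r ?invr_ge0 ?(ltW UU0) // ler_nat mulnS addnC mulnC leq_add2l.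
  exact: ltnW.
have /andP[s1 s2] := sP l; move: s1 s2 key; rewrite /plane_pos -/n.
set P := (\sum_(i < k) z i l * a i)%N => s1 s2 /andP[k1 k2].
have nL : (n <= n`!)%N.
  by rewrite -{1}(prednK n0) -(prednK n0) factS leq_pmulr ?fact_gt0.
have L0 := fact_gt0 n.
have e1 : (s l)%:R / U%:R <= (u l + P + (k + 2) * n`!)%:R / U%:R :> R.
  by rewrite ler_wpM2r ?invr_ge0 ?(ltW UU0) // ler_nat; nia.
have e2 : (u l + 1 + \sum_(i < k) (z i l * a i + n))%:R / U%:R
  <= (s l + (k + 2) * n`!)%:R / U%:R :> R.
  have -> : (\sum_(i < k) (z i l * a i + n)
    = P + k * n)%N by rewrite big_split /= sum_nat_const card_ord.
  have knL : (k * n <= k * n`!)%N by rewrite leq_mul2l nL orbT.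
  rewrite ler_wpM2r ?invr_ge0 ?(ltW UU0) // ler_nat mulnDl; move: s1 knL L0.
  move: s2; clear k1 k2 e1; clearbody P; move: (k * n)%N (k * n`!)%N P (n`!) (u l) (s l); lia.
have e3 : ((k + 2) * n`!)%:R / U%:R = (k + 2)%:R / (2 ^ J)%:R :> R.
  rewrite /U !natrM; move: L0; rewrite -(ltr0n R); move: (n`!)%:R => x x0.
  by field; rewrite (gt_eqF x0) pnatr_eq0 expn_eq0.
move: e1 e2; rewrite !natrD !mulrDl e3; move: k1 k2; rewrite !natrD !mulrDl.
move=> k1 k2 e1 e2; rewrite ler_norml; apply/andP; split; lra.
Qed.

End Scale.

Lemma discrete_cover (eta delta : R) (B : seq ('rV[R]_(k + m) * 'rV[R]_(k + m))) :
  2 ^+ k * eta <= 2^-1 -> 0 < delta ->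
  (forall b, b \in B -> forall c, b.1 0 c <= b.2 0 c) ->
  \sum_(b <- B) \prod_c (b.2 0 c - b.1 0 c + delta) <= eta ->
  exists J (Bd : forall j, pred (cell_index m k K j)),
  (forall j, (j < J)%N -> #|Bd j|%:R <= (256 * (8 * m) ^ k * (2 * K + 1) ^ (m * k))%:R * eta *
     (cell_res m k j)%:R ^+ (m + m * k) * (j.+2%:R ^+ (k + 4) / 2 ^+ j ^+ k)) /\
  (forall y : 'M[R]_(k.+1, m), (forall i l, `|y i l| <= K%:R) ->
    (forall x : 'rV[R]_k, (forall i, 0 <= x 0 i <= 1) -> forall w : 'rV[R]_m,
     (forall l, `|w 0 l - plane_val y x 0 l| <= delta) -> has (cbox (row_mx x w)) B) ->
    exists2 j, (j < J)%N & exists2 c : cell_index m k K j, Bd j c &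
      forall i l, - K%:R + (c (i, l))%:R / (cell_res m k j)%:R <= y i l
        <= - K%:R + (c (i, l)).+1%:R / (cell_res m k j)%:R).
Proof.
move=> eta_small delta0 Ble Beta.
(* The choice gives 2^J > J >= (k + 2) / delta, the precision needed in [grid_saturated]. *)
pose J := (Num.truncn ((k + 2)%:R / delta)).+1.
have Jdelta : (k + 2)%:R / (2 ^ J)%:R <= delta.
  rewrite ler_pdivrMr ?ltr0n ?expn_gt0 // mulrC -ler_pdivrMr //.
  have x0 : 0 <= (k + 2)%:R / delta by rewrite divr_ge0 // ltW.
  have /andP[_ /ltW h] := truncn_itv x0; apply: le_trans h _.
  by rewrite ler_nat; apply: ltnW; apply: ltn_expl.
(* As 2^nu > nu, this one choice yields J <= nu, resolutions below n, and 1 / n <= 1 / 2^J <=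
   delta. *)
pose nu := (cell_res m k J + J)%N.
have J_nu : (J <= nu)%N by rewrite leq_addl.
have cell_res_lt j : (j < J)%N -> (cell_res m k j < 2 ^ nu)%N.
  move=> jJ; apply: (@leq_ltn_trans (cell_res m k J)).
    by rewrite /cell_res !leq_mul // ?leq_exp2l ?leq_exp2r // ltnW.
  by apply: leq_ltn_trans (ltn_expl nu (isT : (1 < 2)%N)); rewrite leq_addr.
have ndelta : (2 ^ nu)%:R^-1 <= delta.
  apply: le_trans Jdelta; apply: (@le_trans _ _ ((2 ^ J)%:R^-1)).
    by rewrite lef_pV2 ?posrE ?ltr0n ?expn_gt0 // ler_nat leq_exp2l.
  by rewrite ler_peMl ?invr_ge0 // ler1n addn2.
have Fs := @grid_F_small nu J B delta eta delta0 ndelta Ble Beta.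
exists J, (fun j c => heavy R J (@grid_F nu J B) c); split=> [j jJ|y yK yB].
  exact: (heavy_count m0 k0 eta_small Fs cell_res_lt J_nu jJ).
set n := (2 ^ nu)%N in Fs cell_res_lt ndelta.
pose D := (n.-1`! * 2 ^ J)%N; pose U := (n`! * 2 ^ J)%N.
have y0 i l : 0 <= y i l + K%:R <= 2 * K%:R.
  by have /ler_normlP[? ?] := yK i l; apply/andP; split; lra.
(* The factor is 2K + 1 and not 2K because y = K may occur. *)
have tr i l (N : nat) : (0 < N)%N -> let t := Num.truncn ((y i l + K%:R) * N%:R) in
    (t < (2 * K + 1) * N)%N /\ t%:R / N%:R <= y i l + K%:R <= t.+1%:R / N%:R.
  move=> N0 t; have N0' : 0 < N%:R :> R by rewrite ltr0n.
  have /andP[y1 y2] := y0 i l.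
  have /andP[t1 /ltW t2] := truncn_itv (mulr_ge0 y1 (ltW N0')).
  rewrite ler_pdivrMr // ler_pdivlMr // t1 t2; split=> //.
  rewrite -(ltr_nat R); apply: le_lt_trans t1 _; rewrite natrM ltr_pM2r // natrD natrM; lra.
have n0 : (0 < n)%N by rewrite expn_gt0.
have U0 : (0 < U)%N by rewrite muln_gt0 fact_gt0 expn_gt0.
have D0 : (0 < D)%N by rewrite muln_gt0 fact_gt0 expn_gt0.
pose u l := Num.truncn ((y ord0 l + K%:R) * U%:R).
pose z (i : 'I_k) l := Num.truncn ((y (lift ord0 i) l + K%:R) * D%:R).
have gd : saturated (@grid_F nu J B) u z.
  apply: (grid_saturated Jdelta _ _ yB) => [l|i l]; first by have [] := tr ord0 l _ U0.
  by have [] := tr (lift ord0 i) l _ D0.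
have [j jJ [c [cbad cell_base_pt cell_dir_pt]]] := saturated_heavy m0 k0 eta_small Fs cell_res_lt
  (fun l => (tr ord0 l _ U0).1) (fun i l => (tr (lift ord0 i) l _ D0).1) gd.
exists j => //; exists c => //.
(* A grid interval of length 1/N lies in the cell interval named by the quotient of its index. *)
have loc (t d N : nat) (v : R) (q : nat) : (0 < d)%N -> (d * cell_res m k j = N)%N ->
  t%:R / N%:R <= v + K%:R <= t.+1%:R / N%:R ->
   (t %/ d = q)%N -> - K%:R + q%:R / (cell_res m k j)%:R <= v
     <= - K%:R + q.+1%:R / (cell_res m k j)%:R.
  move=> d0 dN /andP[h1 h2] tq; have l0 := cell_res_gt0 k m0 j.
  have N0 : 0 < N%:R :> R by rewrite ltr0n -dN muln_gt0 d0 l0.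
  have e (p : nat) : p%:R / (cell_res m k j)%:R = (p * d)%:R / N%:R :> R.
    by rewrite -dN (natrM _ p d) (natrM _ d) [p%:R * d%:R]mulrC
      -[RHS]mulf_div divff ?mul1r // pnatr_eq0 -lt0n.
  have t1 : q%:R / (cell_res m k j)%:R <= t%:R / N%:R :> R.
    by rewrite e ler_wpM2r ?invr_ge0 ?(ltW N0) // ler_nat -tq leq_trunc_div.
  have t2 : t.+1%:R / N%:R <= q.+1%:R / (cell_res m k j)%:R :> R.
    by rewrite e ler_wpM2r ?invr_ge0 ?(ltW N0) // ler_nat -tq ltn_ceil.
  by apply/andP; split; lra.
move=> i l; have [i' ->|->] := unliftP ord0 i.
  apply: (loc _ _ _ _ _ (cell_dir_gt0 m0 cell_res_lt jJ) (cell_dirE m0 cell_res_lt jJ) _ (cell_dir_pt i' l)).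
  by have [] := tr (lift ord0 i') l _ D0.
apply: (loc _ _ _ _ _ (cell_base_gt0 m0 cell_res_lt jJ) (cell_baseE m0 cell_res_lt jJ) _ (cell_base_pt l)).
by have [] := tr ord0 l _ U0.
Qed.

End DiscreteCover.

(** * Hausdorff measure *)

Lemma bernoulli_le (R : realFieldType) (h : R) j : 0 <= h -> 1 + j%:R * h <= (1 + h) ^+ j.
Proof.
move=> h0; elim: j => [|j IH]; first by rewrite mul0r addr0 expr0.
rewrite exprS; apply: le_trans (ler_wpM2l _ IH); last by rewrite addr_ge0.
have := mulr_ge0 h0 (mulr_ge0 (ler0n _ j) h0); rewrite -[j.+1%:R]natr1; nra.
Qed.

(** With q the square root of r, one factor j + 2 is absorbed by q^j through Bernoulli's inequality
    and the remaining power by the induction hypothesis at q. *)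
Lemma poly_geom_bound (R : realType) p (r : R) : 0 < r < 1 ->
  exists C, forall j, j.+2%:R ^+ p * r ^+ j <= C.
Proof.
elim: p r => [|p IH] r /andP[r0 r1].
  by exists 1 => j; rewrite expr0 mul1r exprn_ile1 // ltW.
pose q := Num.sqrt r.
have q0 : 0 < q by rewrite sqrtr_gt0.
have q1 : q < 1 by rewrite -sqrtr1 ltr_sqrt.
have rq : r = q * q by rewrite -expr2 sqr_sqrtr // ltW.
have [C HC] := IH q (introT andP (conj q0 q1)).
have [C' HC'] : exists C', forall j, j.+2%:R * q ^+ j <= C'.
  pose h := q^-1 - 1; have h0 : 0 < h by rewrite subr_gt0 invf_gt1.
  exists (2 + h^-1) => j; have := bernoulli_le j (ltW h0).
  rewrite {2}/h addrCA subrr addr0 exprVn => B.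
  rewrite -ler_pdivlMr ?exprn_gt0 //; apply: le_trans (ler_wpM2l _ B); last first.
    by rewrite addr_ge0 ?invr_ge0 // ltW.
  have -> : (2 + h^-1) * (1 + j%:R * h) = 2 + h^-1 + 2 * (j%:R * h) + j%:R.
    by field; rewrite gt_eqF.
  have hV : 0 <= h^-1 by rewrite invr_ge0 ltW.
  have jh : 0 <= j%:R * h by rewrite mulr_ge0 // ltW.
  by rewrite -![_.+2%:R]natr1 -[j.+1%:R]natr1; lra.
exists (C * C') => j.
rewrite rq exprMn exprSr mulrACA; apply: ler_pM => //.
- by rewrite mulr_ge0 ?exprn_ge0 // ltW.
- by rewrite mulr_ge0 ?exprn_ge0 // ltW.
Qed.

(** Half of the decay bounds the polynomial, the other half sums as a geometric series. *)
Lemma poly_geom_sum (R : realType) p (r : R) : 0 < r < 1 ->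
  exists2 C, 0 < C & forall J, \sum_(j < J) j.+2%:R ^+ p * r ^+ j <= C.
Proof.
move=> /andP[r0 r1]; pose q := Num.sqrt r.
have q0 : 0 < q by rewrite sqrtr_gt0.
have q1 : q < 1 by rewrite -sqrtr1 ltr_sqrt.
have rq : r = q * q by rewrite -expr2 sqr_sqrtr // ltW.
have [C HC] := @poly_geom_bound R p q (introT andP (conj q0 q1)).
have C0 : 0 < C by apply: lt_le_trans (HC 0%N); rewrite expr0 mulr1 exprn_gt0.
have q1' : 0 < 1 - q by rewrite subr_gt0.
exists (C / (1 - q)); first by rewrite divr_gt0.
move=> J; apply: (@le_trans _ _ (\sum_(j < J) C * q ^+ j)).
  apply: ler_sum => j _; rewrite rq exprMn mulrA ler_wpM2r ?HC //.
  by rewrite exprn_ge0 // ltW.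
rewrite -mulr_sumr ler_wpM2l ?(ltW C0) // -[(1 - q)^-1]mul1r ler_pdivlMr // mulrC.
have -> : (1 - q) * \sum_(j < J) q ^+ j = 1 - q ^+ J.
  by rewrite -[RHS]opprB subrX1; ring.
by rewrite lerBlDr lerDl exprn_ge0 // ltW.
Qed.

(** A list may repeat a set, which only enlarges the right-hand side. *)
Lemma hausdorff_premeasure_seq (R : realType) (T : Type) (dist : T -> T -> R) (s delta : R)
    (A : set T) (l : seq (set T)) :
  A `<=` \bigcup_(U in [set` l]) U -> (forall U, U \in l -> (diameter dist U <= delta%:E)%E) ->
  (hausdorff_premeasure dist s delta A <= \sum_(U <- l) poweR (diameter dist U) s)%E.
Proof.
move=> Al ld.
apply: (@le_trans _ _ (\esum_(U in [set` l]) poweR (diameter dist U) s)%E).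
  apply: ereal_inf_lbound; exists [set` l] => //; split => //.
  exact/finite_set_countable/finite_seq.
rewrite (esum_fset (finite_seq l) (fun U _ => poweR_ge0 _ _)).
have -> : [set` l] = [set` undup l].
  by apply/seteqP; split => U /=; rewrite mem_undup.
rewrite -fsbig_seq ?undup_uniq //.
elim: l {Al ld} => [|U l IH] //=; rewrite big_cons.
case: ifP => _; first by apply: le_trans IH _; rewrite leeDr // poweR_ge0.
by rewrite big_cons leeD2l.
Qed.

Lemma diameter_le (R : realType) (T : Type) (dist : T -> T -> R) (U : set T) (c : R) :
  0 <= c -> (forall x y, U x -> U y -> dist x y <= c) -> (diameter dist U <= c%:E)%E.
Proof.
move=> c0 Uc; apply: ge_ereal_sup => _ [->|[[x y] [/= Ux Uy] <-]]; rewrite lee_fin //.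
exact: Uc.
Qed.

Lemma diameter_ge0 (R : realType) (T : Type) (dist : T -> T -> R) (U : set T) :
  (0 <= diameter dist U)%E.
Proof. by apply: ereal_sup_ubound; left. Qed.

Lemma euclidean_dist_le (R : realType) m n (x y : 'M[R]_(m, n)) (c : R) :
  0 <= c -> (forall i j, `|x i j - y i j| <= c) -> euclidean_dist x y <= (m * n)%:R * c.
Proof.
move=> c0 xy; have mnc : 0 <= (m * n)%:R * c by rewrite mulr_ge0.
rewrite /euclidean_dist -(ger0_norm mnc) -sqrtr_sqr ler_sqrt ?sqr_ge0 //.
apply: (@le_trans _ _ (\sum_(i < m) \sum_(j < n) c ^+ 2)).
  apply: ler_sum => i _; apply: ler_sum => j _.
  by rewrite -real_normK ?num_real // lerXn2r ?nnegrE.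
under eq_bigr do rewrite sumr_const card_ord.
rewrite sumr_const card_ord -mulrnA -[leLHS]mulr_natl mulnC exprMn ler_wpM2r ?sqr_ge0 //.
by rewrite -natrX ler_nat; case: (m * n)%N => // a; rewrite expnS leq_pmulr.
Qed.

(** * Summation over the cells of all levels *)

Section Assembly.
Variables (R : realType) (m k K : nat).
Hypotheses (m0 : (0 < m)%N) (k0 : (0 < k)%N).
Let N := (k.+1 * m)%N.

Definition cell j (c : cell_index m k K j) : set 'M[R]_(k.+1, m) :=
  [set y | forall i l, - K%:R + (c (i, l))%:R / (cell_res m k j)%:R <= y i l
     <= - K%:R + (c (i, l)).+1%:R / (cell_res m k j)%:R].

Lemma cell_diameter j (c : cell_index m k K j) :
  (diameter (@euclidean_dist R k.+1 m) (cell c) <= (N%:R / (cell_res m k j)%:R)%:E)%E.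
Proof.
apply: diameter_le => [|x y xc yc]; first by rewrite divr_ge0.
apply: euclidean_dist_le; rewrite ?invr_ge0 // => i l.
have /andP[x1 x2] := xc i l; have /andP[y1 y2] := yc i l.
rewrite -natr1 mulrDl mul1r in x2 y2.
by rewrite ler_norml; apply/andP; split; lra.
Qed.

(** With sigma = s - (N - k) > 0, the cell resolution enters to the power k - sigma. Its factor 2^(j
    k) cancels against the smoothing gain, and 2^(-j sigma) sums against the remaining powers of j +
    2. *)
Lemma cell_sum_bound (s : R) : N%:R - k%:R < s -> s <= N%:R ->
  exists2 C, 0 < C & forall (eta : R) J (b : nat -> nat), 0 <= eta ->
   (forall j, (j < J)%N -> (b j)%:R <= (256 * (8 * m) ^ k * (2 * K + 1) ^ (m * k))%:R * eta *
     (cell_res m k j)%:R ^+ (m + m * k) * (j.+2%:R ^+ (k + 4) / 2 ^+ j ^+ k)) ->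
   \sum_(j < J) (b j)%:R * (N%:R / (cell_res m k j)%:R) `^ s <= C * eta.
Proof.
move=> sk sN.
pose Cl := (2 ^ k * 256 * m * (k + 1))%N.
have Cl0 : (0 < Cl)%N by rewrite !muln_gt0 expn_gt0 m0 addn1.
pose sigma := s - (N%:R - k%:R).
have sigma0 : 0 < sigma by rewrite subr_gt0.
pose r : R := 2 `^ (- sigma).
have r0 : 0 < r by rewrite powR_gt0.
have r1 : r < 1.
  rewrite /r powRN invf_lt1 ?powR_gt0 //.
  have {1}-> : 1 = 1 `^ sigma :> R by rewrite powR1.
  by apply: gt0_ltr_powR; rewrite ?nnegrE ?ltr1n.
have [C C0 HC] := @poly_geom_sum R (k + 4 + (2 * k)) r (introT andP (conj r0 r1)).
pose C1 : R := (256 * (8 * m) ^ k * (2 * K + 1) ^ (m * k))%:R.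
have C10 : 0 < C1 by rewrite ltr0n !muln_gt0 !expn_gt0 muln_gt0 m0 addn1.
have N0 : (0 < N)%N by rewrite muln_gt0 m0.
exists (C1 * N%:R `^ s * Cl%:R ^+ k * C).
  have Ns : 0 < N%:R `^ s by rewrite powR_gt0 // ltr0n.
  have Clk : 0 < Cl%:R ^+ k :> R by rewrite exprn_gt0 // ltr0n.
  by rewrite !mulr_gt0.
move=> eta J b eta0 Hb.
apply: (@le_trans _ _ (\sum_(j < J) (C1 * N%:R `^ s * Cl%:R ^+ k * eta) *
   (j.+2%:R ^+ (k + 4 + 2 * k) * r ^+ j))); last first.
  rewrite -mulr_sumr [leRHS]mulrAC ler_wpM2l // mulr_ge0 //.
  by rewrite !mulr_ge0 ?exprn_ge0 ?powR_ge0 // ltW.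
apply: ler_sum => j _.
have l0 : 0 < (cell_res m k j)%:R :> R by rewrite ltr0n cell_res_gt0.
have e1 : (N%:R / (cell_res m k j)%:R) `^ s = N%:R `^ s * (cell_res m k j)%:R `^ (- s) :> R.
  by rewrite powRM ?invr_ge0 // -powR_inv1 ?(ltW l0) // -powRrM mulN1r.
have e2 : (cell_res m k j)%:R ^+ (m + m * k) * (cell_res m k j)%:R `^ (- s)
   <= Cl%:R ^+ k * j.+2%:R ^+ (2 * k) * (2 ^+ j) ^+ k * r ^+ j :> R.
  have -> : (m + m * k = N)%N by rewrite /N mulSn mulnC.
  rewrite -powR_mulrn ?(ltW l0) // -powRD; last by rewrite (gt_eqF l0) implybT.
  have -> : cell_res m k j = (Cl * j.+1 ^ 2 * 2 ^ j)%N by rewrite /cell_res -/Cl; ring.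
  have -> : N%:R - s = k%:R - sigma by rewrite /sigma; ring.
  set a := (Cl * j.+1 ^ 2)%N; have a0 : (0 < a)%N by rewrite muln_gt0 Cl0 expn_gt0.
  rewrite natrM powRM // -[leRHS]mulrA ler_pM ?powR_ge0 //.
    apply: (@le_trans _ _ (a%:R `^ k%:R)).
      by apply: ler_powR; rewrite ?ler1n // gerBl ltW.
    rewrite powR_mulrn // /a natrM natrX exprMn -exprM ler_wpM2l ?exprn_ge0 //.
    by rewrite lerXn2r ?nnegrE // ler_nat.
  rewrite natrX powRD; last by rewrite (gt_eqF (exprn_gt0 _ _)) ?implybT.
  rewrite powR_mulrn ?exprn_ge0 // ler_wpM2l ?exprn_ge0 //.
  by rewrite -(powR_mulrn j (ler0n R 2)) powRAC powR_mulrn ?powR_ge0.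
apply: le_trans (ler_wpM2r (powR_ge0 _ _) (Hb _ (ltn_ord j))) _.
rewrite e1 -/C1.
have p0 : 0 < (2 ^+ j) ^+ k :> R by rewrite !exprn_gt0.
rewrite [leLHS](_ : _ = (C1 * N%:R `^ s * eta * (j.+2%:R ^+ (k + 4) / (2 ^+ j) ^+ k)) *
  ((cell_res m k j)%:R ^+ (m + m * k) * (cell_res m k j)%:R `^ (- s))); last by ring.
rewrite [leRHS](_ : _ = (C1 * N%:R `^ s * eta * (j.+2%:R ^+ (k + 4) / (2 ^+ j) ^+ k)) *
  (Cl%:R ^+ k * j.+2%:R ^+ (2 * k) * (2 ^+ j) ^+ k * r ^+ j)).
  rewrite ler_wpM2l // mulr_ge0 ?divr_ge0 ?exprn_ge0 //.
  by rewrite !mulr_ge0 ?powR_ge0 // ltW.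
rewrite exprD; move: ((2 ^+ j) ^+ k) p0 => p p0.
by field; rewrite gt_eqF.
Qed.

Lemma hausdorff_measure0 (s : R) (S : set 'M[R]_(k.+1, m)) : N%:R - k%:R < s -> s <= N%:R ->
  0 < s ->
  (forall y, S y -> forall i l, `|y i l| <= K%:R) ->
  (forall eta : R, 0 < eta -> exists (delta : R) (B : seq ('rV[R]_(k + m) * 'rV[R]_(k + m))),
    [/\ 0 < delta, forall b, b \in B -> forall c, b.1 0 c <= b.2 0 c,
     \sum_(b <- B) \prod_c (b.2 0 c - b.1 0 c + delta) <= eta &
     forall y, S y -> forall x : 'rV[R]_k, (forall i, 0 <= x 0 i <= 1) -> forall w : 'rV[R]_m,
       (forall l, `|w 0 l - plane_val y x 0 l| <= delta) -> has (cbox (row_mx x w)) B]) ->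
  hausdorff_measure (@euclidean_dist R k.+1 m) s S = 0%E.
Proof.
move=> sk sN s0 SK SB; have [C C0 HC] := cell_sum_bound sk sN.
apply/eqP; rewrite eq_le; apply/andP; split; last first.
  apply: ereal_sup_ge; exists (hausdorff_premeasure (@euclidean_dist R k.+1 m) s 1 S).
    by exists 1 => //=; exact: ltr01.
  by apply: le_ereal_inf_tmp => _ [D _ <-]; apply: esum_ge0 => U _; exact: poweR_ge0.
apply: ge_ereal_sup => _ [d /= d0 <-].
apply/lee_addgt0Pr => e e0; rewrite add0e.
have N0 : (0 < N)%N by rewrite muln_gt0 m0.
(* The three bounds serve the pigeonhole at scale 0, the total of the cover, and the diameter of its
   members. *)
pose eta := Num.min ((2 ^+ k)^-1 / 2) (Num.min (e / C) (d `^ s / C)).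
have eta0 : 0 < eta by rewrite !lt_min !divr_gt0 ?powR_gt0 ?invr_gt0 ?exprn_gt0.
have eta1 : 2 ^+ k * eta <= 2^-1.
  by rewrite -ler_pdivlMl ?exprn_gt0 // ge_min lexx.
have eta2 : C * eta <= e by rewrite -ler_pdivlMl // mulrC !ge_min lexx orbT.
have eta3 : C * eta <= d `^ s by rewrite -ler_pdivlMl // mulrC !ge_min lexx !orbT.
have [delta [B [delta0 Ble Beta SB']]] := SB _ eta0.
have [J [Bd [Bdn Bdc]]] := @discrete_cover R m k K m0 k0 eta delta B eta1 delta0 Ble Beta.
pose b j := #|Bd j|.
have Hsum := HC eta J b (ltW eta0) Bdn.
pose lj j := [seq cell c | c <- enum (Bd j)].
pose l := flatten [seq lj j | j <- iota 0 J].
(* A single cell already contributes its term to a sum of at most C eta <= d^s, so a small eta rules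
   out large cells. *)
have cell_small j c : (j < J)%N -> c \in Bd j -> N%:R / (cell_res m k j)%:R <= d.
  move=> jJ Bc; rewrite leNgt; apply/negP => dlt.
  have : d `^ s < (N%:R / (cell_res m k j)%:R) `^ s.
    by apply: gt0_ltr_powR; rewrite ?nnegrE ?divr_ge0 // ltW.
  rewrite ltNge => /negP; apply; apply: le_trans _ eta3; apply: le_trans _ Hsum.
  rewrite (bigD1 (Ordinal jJ)) //= -[leLHS]mul1r; apply: ler_wpDr.
    by apply: sumr_ge0 => i _; rewrite mulr_ge0 ?powR_ge0.
  by rewrite ler_wpM2r ?powR_ge0 // ler1n /b; apply/card_gt0P; exists c.
apply: le_trans (@hausdorff_premeasure_seq _ _ _ _ _ _ l _ _) _.
- move=> y Sy; have [j jJ [c Bc yc]] := Bdc y (SK y Sy) (SB' y Sy).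
  exists (cell c) => //=; apply/flattenP; exists (lj j).
    by apply: map_f; rewrite mem_iota.
  by apply: map_f; rewrite mem_enum.
- move=> U /flattenP[_ /mapP[j + ->] /mapP[c + ->]]; rewrite mem_iota /= => jJ;
  rewrite mem_enum => Bc.
  by apply: le_trans (cell_diameter c) _; rewrite lee_fin (cell_small j c).
apply: (@le_trans _ _ (\sum_(j < J) (b j)%:R * (N%:R / (cell_res m k j)%:R) `^ s)%:E); last first.
  by rewrite lee_fin; apply: le_trans Hsum eta2.
rewrite /l big_flatten /= big_map /= -sumEFin.
rewrite -(big_mkord xpredT (fun j => ((b j)%:R * (N%:R / (cell_res m k j)%:R) `^ s)%:E)).
rewrite /index_iota subn0; apply: lee_sum => j _.
rewrite big_map big_enum /=.
apply: (@le_trans _ _ (\sum_(c in Bd j) ((N%:R / (cell_res m k j)%:R) `^ s)%:E)%E).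
  apply: lee_sum => c _; rewrite -poweR_EFin; apply: gt0_ler_poweR (cell_diameter c).
  - exact: ltW.
  - by rewrite in_itv /= diameter_ge0 leey.
  - by rewrite in_itv /= lee_fin divr_ge0 // leey.
by rewrite sumEFin sumr_const lee_fin -[leLHS]mulr_natl lexx.
Qed.

End Assembly.

(** * Caratheodory measurability *)

Lemma esum_subset (R : realType) (T : choiceType) (A B : set T) (a : T -> \bar R) :
  A `<=` B -> (\esum_(i in A) a i <= \esum_(i in B) a i)%E.
Proof.
move=> AB; apply: ge_ereal_sup => _ [X [finX XA] <-]; apply: ereal_sup_ubound.
by exists X => //; split => //; exact: subset_trans AB.
Qed.

(** One preimage is kept for each value. It serves for cutting boxes, where distinct boxes may have
    the same piece. *)
Lemma esum_image_le (R : realType) (T T' : choiceType) (B : set T)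
    (f : T -> T') (a : T' -> \bar R) :
  (\esum_(j in f @` B) a j <= \esum_(i in B) a (f i))%E.
Proof.
have [h hP] : {h : T' -> option T & forall y, (f @` B) y ->
  exists2 x, h y = Some x & B x /\ f x = y}.
  apply: (@choice _ _ (fun y o => (f @` B) y -> exists2 x, o = Some x & B x /\ f x = y)) => y.
  have [[x Bx fx]|nB] := pselect ((f @` B) y); last by exists None.
  by exists (Some x) => _; exists x.
pose P := [set x | B x /\ h (f x) = Some x].
have -> : f @` B = f @` P.
  apply/seteqP; split=> y; last by move=> [x [Bx _] <-]; exists x.
  by move=> yB; have [x hx [Bx fx]] := hP y yB; exists x => //; split; rewrite ?fx.
rewrite esum_image; first by apply: esum_subset => x [].
by move=> x x' /set_mem[_ hx] /set_mem[_ hx'] grid_ind; move: hx; rewrite grid_ind hx' => -[].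
Qed.

Lemma continuous_mx (R : realType) (X : topologicalType) m n (f : X -> 'M[R]_(m, n)) :
  (forall i j, continuous (fun x => f x i j)) -> continuous f.
Proof.
move=> fc x A [P MP sPA]; suff : \forall y \near x, forall i j, P i j (f y i j).
  by apply: filterS => y Py; apply: sPA.
apply: filter_forall => i; apply: filter_forall => j.
exact: (fc i j x _ (MP i j)).
Qed.

Lemma continuous_sumr (R : realType) (X : topologicalType) (I : Type) (r : seq I)
    (f : I -> X -> R) :
  (forall i, continuous (f i)) -> continuous (fun x => \sum_(i <- r) f i x).
Proof.
move=> fc x; elim: r => [|i r IH].
  under eq_fun do rewrite big_nil; exact: cvg_cst.
under eq_fun do rewrite big_cons; apply: cvgD => //; exact: fc.
Qed.

Definition obox (R : realType) n (a b : 'rV[R]_n) : set 'rV[R]_n :=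
  [set x | forall i, a 0 i < x 0 i < b 0 i].

Lemma obox_open (R : realType) n (a b : 'rV[R]_n) : open (obox a b).
Proof.
rewrite openE => x xab; exists (fun i j => [set t | a 0 j < t < b 0 j]) => [i j|y yab j].
  have := xab j; rewrite -[i]/(i : 'I_1) (ord1 i) => xj.
  have : open [set t : R | a 0 j < t < b 0 j].
    by rewrite -[X in open X]/[set` `]a 0 j, b 0 j[ ]; exact: interval_open.
  by rewrite openE; apply.
exact: (yab ord0 j).
Qed.

Section Measurability.
Variables (R : realType) (n : nat).
Local Notation mu := (@lebesgue_outer R n).
Local Notation V := 'rV[R]_n.

Definition set_coord (a : V) (i : 'I_n) (c : R) : V := \row_j if j == i then c else a 0 j.

Lemma box_volume_split (a b : V) i c :
  box_volume (a, set_coord b i c) + box_volume (set_coord a i c, b) = box_volume (a, b).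
Proof.
rewrite /box_volume (bigD1 i) //= [in X in _ + X](bigD1 i) //= [RHS](bigD1 i) //=.
rewrite !mxE eqxx.
rewrite (eq_bigr (fun j => b 0 j - a 0 j)) => [|j /negPf ji]; last by rewrite mxE ji.
rewrite [in X in _ + X](eq_bigr (fun j => b 0 j - a 0 j)) => [|j /negPf ji];
  last by rewrite mxE ji.
by rewrite -mulrDl; congr (_ * _); ring.
Qed.

(** The hyperplane cuts every box of a cover into two half-open boxes whose volumes add up, and the
    two families cover the two parts of the set. *)
Lemma halfspace_measurable i (c : R) : mu.-cara.-measurable [set x : V | x 0 i <= c].
Proof.
apply: le_caratheodory_measurable => X; apply: le_ereal_inf_tmp => _ [B [cB Bab XB] <-].
(* Clamping c to the side of the box keeps both pieces admissible when the hyperplane misses the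
   box; one of them is then degenerate. *)
pose cl (ab : V * V) := Num.max (ab.1 0 i) (Num.min (ab.2 0 i) c).
pose lf (ab : V * V) := (ab.1, set_coord ab.2 i (cl ab)).
pose rt (ab : V * V) := (set_coord ab.1 i (cl ab), ab.2).
have clP ab : B ab -> ab.1 0 i <= cl ab <= ab.2 0 i.
  by move=> /Bab/(_ i) abi; rewrite /cl le_max lexx /= ge_max abi ge_min lexx.
have vol_ge0 (ab : V * V) : (forall j, ab.1 0 j <= ab.2 0 j) -> (0 <= (box_volume ab)%:E)%E.
  by move=> abj; rewrite lee_fin; apply: prodr_ge0 => j _; rewrite subr_ge0.
have lf_le ab : B ab -> forall j, (lf ab).1 0 j <= (lf ab).2 0 j.
  by move=> Ba j; rewrite mxE; case: eqP => [->|_]; [case/andP: (clP _ Ba)|exact: (Bab _ Ba j)].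
have rt_le ab : B ab -> forall j, (rt ab).1 0 j <= (rt ab).2 0 j.
  by move=> Ba j; rewrite mxE; case: eqP => [->|_]; [case/andP: (clP _ Ba)|exact: (Bab _ Ba j)].
have -> : (\esum_(ab in B) (box_volume ab)%:E =
   \esum_(ab in B) (box_volume (lf ab))%:E + \esum_(ab in B) (box_volume (rt ab))%:E)%E.
  rewrite -esumD => [|ab Ba|ab Ba]; [|exact/vol_ge0/lf_le|exact/vol_ge0/rt_le].
  by apply: eq_esum => -[a b] _; rewrite -EFinD box_volume_split.
pose vol (ab : V * V) : \bar R := (box_volume ab)%:E.
apply: leeD.
- apply: le_trans _ (esum_image_le B lf vol); apply: ereal_inf_lbound.
  exists (lf @` B) => //; split; first exact: card_le_trans (card_image_le _ _) cB.
    by move=> _ [ab Ba <-]; exact: lf_le.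
  move=> x [Xx xc]; have [ab Ba xab] := XB x Xx; exists (lf ab); first by exists ab.
  move=> j; have /andP[x1 x2] := xab j; rewrite /= x1 mxE; case: eqP => // ji.
  by rewrite ji in x1 x2 *; rewrite /cl le_max le_min x2 xc orbT.
- apply: le_trans _ (esum_image_le B rt vol); apply: ereal_inf_lbound.
  exists (rt @` B) => //; split; first exact: card_le_trans (card_image_le _ _) cB.
    by move=> _ [ab Ba <-]; exact: rt_le.
  move=> x [Xx /negP]; rewrite -ltNge => xc; have [ab Ba xab] := XB x Xx; exists (rt ab);
    first by exists ab.
  move=> j; have /andP[x1 x2] := xab j; rewrite /= x2 andbT mxE; case: eqP => // ji.
  by rewrite ji in x1 *; rewrite /cl gt_max x1 gt_min xc orbT.
Qed.

Lemma box_measurable (ab : V * V) : mu.-cara.-measurable (box ab).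
Proof.
have -> : box ab = \bigcap_(i in [set: 'I_n]) ([set x : V | x 0 i
  <= ab.2 0 i] `\` [set x : V | x 0 i <= ab.1 0 i]).
  apply/seteqP; split=> x.
    by move=> xab i _; have /andP[x1 x2] := xab i; split => //=; apply/negP; rewrite -ltNge.
  by move=> xab i; have [/= x2 /negP] := xab i I; rewrite -ltNge => x1; apply/andP.
apply: fin_bigcap_measurable => [|i _]; first exact: finite_finset.
by apply: measurableD; exact: halfspace_measurable.
Qed.

Lemma open_cara_measurable (U : set V) : open U -> mu.-cara.-measurable U.
Proof.
move=> oU.
(* Boxes not contained in U yield the empty set, so the union can run over all pairs of rational
   vectors, a countable type. *)
pose F (pq : 'rV[rat]_n * 'rV[rat]_n) : set V :=
  [set x | box (map_mx ratr pq.1, map_mx ratr pq.2) `<=` U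
    /\ box (map_mx ratr pq.1, map_mx ratr pq.2) x].
have -> : U = \bigcup_pq F pq.
  apply/seteqP; split=> [x Ux|x [pq _ [pqU]]]; last exact: pqU.
  have [P xP sPU] : nbhs x U by exact: open_nbhs_nbhs.
  have H i : exists pq : rat * rat, [/\ (ratr pq.1 : R) < x 0 i, x 0 i < ratr pq.2 &
      forall t : R, ratr pq.1 < t <= ratr pq.2 -> P 0 i t].
    have /nbhs_ballP[e /= e0 eP] := xP 0 i.
    have /rat_in_itvoo[p] : x 0 i - e < x 0 i by rewrite ltrBlDr ltrDl.
    have /rat_in_itvoo[q] : x 0 i < x 0 i + e by rewrite ltrDl.
    rewrite !in_itv /= => /andP[q1 q2] /andP[p1 p2]; exists (p, q); split => //= t /andP[t1 t2].
    by apply: eP; rewrite /ball /= ltr_distlC; apply/andP; split; lra.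
  have [f fP] := choice H.
  exists (\row_i (f i).1, \row_i (f i).2) => //; split.
    move=> t tb; apply: sPU => j i; rewrite (ord1 j); have [_ _] := fP i; apply.
    by have := tb i; rewrite /= !mxE.
  by move=> i; rewrite /= !mxE; have [-> /ltW -> _] := fP i.
apply: countable_bigcupT_measurable; first exact: countableP.
move=> pq; have [sub|nsub] := pselect (box (map_mx ratr pq.1, map_mx ratr pq.2) `<=` U).
  have -> : F pq = box (map_mx ratr pq.1, map_mx ratr pq.2).
    by apply/seteqP; split => x // [].
  exact: box_measurable.
have -> : F pq = set0 by apply/seteqP; split => x // [].
exact: measurable0.
Qed.

Lemma closed_cara_measurable (U : set V) : closed U -> mu.-cara.-measurable U.
Proof.
by move=> cU; rewrite -[U]setCK; apply/measurableC/open_cara_measurable/closed_openC.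
Qed.
End Measurability.

(** * The union of the planes *)

Lemma ex_pos_lower (R : realFieldType) (T : eqType) (l : seq T) (f : T -> R) :
  (forall x, x \in l -> 0 < f x) -> exists2 t, 0 < t & forall x, x \in l -> t <= f x.
Proof.
elim: l => [|a l IH] fl; first by exists 1.
have [|t t0 tl] := IH; first by move=> x xl; apply: fl; rewrite inE xl orbT.
exists (Num.min (f a) t); first by rewrite lt_min t0 fl ?inE ?eqxx.
move=> x; rewrite inE => /orP[/eqP->|/tl]; first by rewrite ge_min lexx.
by rewrite ge_min => ->; rewrite orbT.
Qed.

(* A half-open box with a side of length 0 is empty and can be dropped; the others are
   inflated to at most twice their size. *)
Lemma null_compact_boxes (R : realType) n (A : set 'rV[R]_n) (eta : R) :
  compact A -> lebesgue_outer A = 0%E -> 0 < eta ->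
  exists (delta : R) (B : seq ('rV[R]_n * 'rV[R]_n)),
    [/\ 0 < delta, forall b, b \in B -> forall c, b.1 0 c <= b.2 0 c,
     \sum_(b <- B) \prod_c (b.2 0 c - b.1 0 c + delta) <= eta &
     forall p q : 'rV[R]_n, A p -> (forall c, `|q 0 c - p 0 c| <= delta) -> has (cbox q) B].
Proof.
move=> cA A0 eta0; pose V := 'rV[R]_n.
(* The factor 2^n pays for doubling every side. *)
have : (lebesgue_outer A < (eta / 2 ^+ n)%:E)%E by rewrite A0 lte_fin divr_gt0 // exprn_gt0.
move=> /ereal_inf_lt[_ [B0 [cB B0le AB0] <-] B0eta].
pose nd (ab : V * V) := forall i, ab.1 0 i < ab.2 0 i.
(* One t makes the boxes open and a second, on each side, leaves room for delta <= t; with the extra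
   delta a side grows by at most 5 t, hence at most doubles. *)
have [t tP] : {t : V * V -> R & forall ab, nd ab ->
  0 < t ab /\ forall i, 5 * t ab <= ab.2 0 i - ab.1 0 i}.
  apply: (@choice _ _ (fun ab t => nd ab -> 0 < t /\ forall i, 5 * t
    <= ab.2 0 i - ab.1 0 i)) => ab.
  have [ndab|] := pselect (nd ab); last by exists 0.
  have [|t t0 tab] := @ex_pos_lower R _ (enum 'I_n) (fun i => (ab.2 0 i - ab.1 0 i) / 5).
    by move=> i _; rewrite divr_gt0 // subr_gt0.
  exists t => _; split=> // i; have := tab i (mem_enum _ i).
  by rewrite ler_pdivlMr // mulrC.
pose D := [set ab | B0 ab /\ nd ab].
pose f (ab : V * V) := obox (ab.1 - const_mx (t ab)) (ab.2 + const_mx (t ab)).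
have : finite_subset_cover D f A.
  have := cA; rewrite compact_cover; apply=> [ab _|x Ax]; first exact: obox_open.
  have [ab Bab xab] := AB0 x Ax; exists ab.
    by split=> // i; have /andP[x1 x2] := xab i; exact: lt_le_trans x1 x2.
  have ndab : nd ab by move=> i; have /andP[x1 x2] := xab i; exact: lt_le_trans x1 x2.
  have [t0 _] := tP ab ndab.
  by move=> i; have /andP[x1 x2] := xab i; rewrite !mxE; apply/andP; split; lra.
move=> [D' D'D AD'].
have D'P ab : ab \in D' -> B0 ab /\ nd ab by move=> /D'D/set_mem.
have [|delta delta0 deltaP] := @ex_pos_lower R _ D' t.
  by move=> ab /D'P[_ /tP[]].
exists delta, [seq (ab.1 - const_mx (2 * t ab), ab.2 + const_mx (2 * t ab)) | ab <- D'].
split=> //.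
- move=> _ /mapP[ab /D'P[_ ndab] ->] c; rewrite !mxE /=.
  have := ndab c; have [] := tP _ ndab; lra.
- rewrite big_map; apply: (@le_trans _ _ (\sum_(ab <- D') 2 ^+ n * box_volume ab)).
    rewrite big_seq [leRHS]big_seq; apply: ler_sum => ab abD'; have [_ ndab] := D'P _ abD'.
    have [t0 tab] := tP _ ndab; have tde := deltaP _ abD'.
    rewrite /box_volume -(prod_const_ord n) -big_split /=; apply: ler_prod => c _.
    by have := tab c; have := ndab c; rewrite !mxE => ? ?; apply/andP; split; lra.
  rewrite -mulr_sumr mulrC -ler_pdivlMr ?exprn_gt0 // -lee_fin -sumEFin.
  apply: le_trans (ltW B0eta); apply: ereal_sup_ubound; exists [set` D'].
    by split=> [|ab /= /D'P[]//]; exact: finite_fset.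
  by rewrite -fsbig_seq // fset_uniq.
- move=> p q Ap qp; have [ab /= abD' pab] := AD' p Ap.
  apply/hasP; exists (ab.1 - const_mx (2 * t ab), ab.2 + const_mx (2 * t ab)); first exact: map_f.
  have tde := deltaP _ abD'.
  apply/forallP => c; rewrite !mxE /=; have := pab c; rewrite !mxE => /andP[p1 p2].
  by have /ler_normlP[q1 q2] := qp c; apply/andP; split; lra.
Qed.

Section Union.
Variables (R : realType) (m k : nat).

Lemma plane_point_continuous :
  continuous (fun yx : 'M[R]_(k.+1, m) * 'rV[R]_k => plane_point yx.1 yx.2).
Proof.
apply: continuous_mx => i c; rewrite (ord1 i) => {i}.
have cx (i : 'I_k) : continuous (fun yx : 'M[R]_(k.+1, m) * 'rV[R]_k => yx.2 0 i).
  move=> yx; apply: (@continuous_comp _ _ _ snd (fun x : 'rV[R]_k => x 0 i));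
    first exact: cvg_snd.
  exact: coord_continuous.
have cy i l : continuous (fun yx : 'M[R]_(k.+1, m) * 'rV[R]_k => yx.1 i l).
  move=> yx; apply: (@continuous_comp _ _ _ fst (fun y : 'M[R]_(k.+1, m) => y i l));
    first exact: cvg_fst.
  exact: coord_continuous.
rewrite /plane_point; case: (split_ordP c) => [i ->|l ->].
  by under eq_fun do rewrite row_mxEl; exact: cx.
under eq_fun do rewrite row_mxEr mxE.
have cs : continuous (fun yx : 'M[R]_(k.+1, m) * 'rV[R]_k =>
    \sum_(i < k) yx.2 0 i * yx.1 (lift ord0 i) l).
  apply: (@continuous_sumr R _ _ _
    (fun (i : 'I_k) (yx : 'M[R]_(k.+1, m) * 'rV[R]_k) => yx.2 0 i * yx.1 (lift ord0 i) l)).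
  by move=> i yx; apply: cvgM; [exact: (cx i yx)|exact: (cy _ _ yx)].
by move=> yx; apply: cvgD; [exact: (cy _ _ yx)|exact: (cs yx)].
Qed.

Variable S : set 'M[R]_(k.+1, m).
Hypothesis cS : compact S.

Definition plane_part (r : R) : set 'rV[R]_(k + m) :=
  [set plane_point yx.1 yx.2 | yx in S `*` [set x : 'rV[R]_k | forall i, `[- r,
    r]%classic (x ord0 i)]].

Lemma plane_part_compact r : compact (plane_part r).
Proof.
apply: continuous_compact; first exact/continuous_subspaceT/plane_point_continuous.
apply: compact_setX => //; apply: (@rV_compact R k (fun=> `[- r, r]%classic)) => i.
exact: segment_compact.
Qed.

Lemma union_plane_part : \bigcup_(y in S) range (plane_point y)
  = \bigcup_(r in [set: nat]) plane_part r%:R.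
Proof.
apply/seteqP; split=> [_ [y Sy [x _ <-]]|_ [r _ [[y x] [/= Sy _] <-]]]; last first.
  by exists y => //; exists x.
have [r rP] : exists r : nat, forall i, `|x ord0 i| <= r%:R.
  exists (\max_i (Num.truncn `|x ord0 i|).+1)%N => i.
  apply: le_trans (ltW (truncnS_gt _)) _; rewrite ler_nat.
  exact: (@leq_bigmax _ (fun i : 'I_k => (Num.truncn `|x ord0 i|).+1) i).
exists r => //; exists (y, x) => //=; split => // i.
by rewrite /= in_itv /= -ler_norml.
Qed.

(** The union is a countable union of compact sets, the parts over the cubes [-r, r]^k. *)
Lemma union_measurable :
  (@lebesgue_outer R (k + m)).-cara.-measurable (\bigcup_(y in S) range (plane_point y)).
Proof.
rewrite union_plane_part; apply: bigcup_measurable => r _; apply: closed_cara_measurable.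
by apply: compact_closed; [exact: norm_hausdorff|exact: plane_part_compact].
Qed.

Lemma union_null_dim (s : R) : (0 < m)%N -> (0 < k)%N ->
  lebesgue_outer (\bigcup_(y in S) range (plane_point y)) = 0%E ->
  (k.+1 * m)%:R - k%:R < s -> s <= (k.+1 * m)%:R -> 0 < s ->
  hausdorff_measure (@euclidean_dist R k.+1 m) s S = 0%E.
Proof.
move=> m0 k0 null sk sN s0.
have [K SK] : exists K : nat, forall y, S y -> forall i l, `|y i l| <= K%:R.
  have [M [_ /(_ (M + 1))]] := compact_bounded cS.
  rewrite ltrDl => /(_ ltr01) SM.
  exists (Num.truncn (M + 1)).+1 => y Sy i l.
  apply: le_trans (le_trans (SM y Sy) (ltW (truncnS_gt _))).
  rewrite [leRHS]mx_normrE; exact: (le_bigmax _ (fun p : 'I_k.+1 * 'I_m => `|y p.1 p.2|) (i, l)).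
apply: (@hausdorff_measure0 R m k K) => // eta eta0.
(* The part over [-1, 1]^k is null and compact and contains the part over [0, 1]^k. *)
have P0 : lebesgue_outer (plane_part 1) = 0%E.
  apply/eqP; rewrite eq_le outer_measure_ge0 andbT -null; apply: le_outer_measure.
  by rewrite union_plane_part => p p1; exists 1%N.
have [delta [B [d0 Ble Beta BP]]] := null_compact_boxes (@plane_part_compact 1) P0 eta0.
exists delta, B; split=> // y Sy x x01 w wP.
apply: (BP (plane_point y x)).
  exists (y, x) => //; split => // i; have /andP[x0 x1] := x01 i.
  by rewrite /= in_itv /= x1 andbT (le_trans _ x0) // oppr_le0.
move=> c; rewrite /plane_point; case: (split_ordP c) => [i ->|l ->].
  by rewrite !row_mxEl subrr normr0 ltW.
by rewrite !row_mxEr; exact: wP.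
Qed.

End Union.

(** Carries the conclusion from dimension k + (d - k) to d; for a variable equality the cast can be
    eliminated. *)
Lemma castmx_measurable_pos (R : realType) n n' (e : n = n') (U : set 'rV[R]_n) :
  (@lebesgue_outer R n).-cara.-measurable U -> (0 < lebesgue_outer U)%E ->
  let V := [set castmx (erefl 1%N, e) p | p in U] in
  (@lebesgue_outer R n').-cara.-measurable V /\ (0 < lebesgue_outer V)%E.
Proof.
case: _ / e => mU U0 /=.
have -> : [set castmx (erefl 1%N, erefl n) p | p in U] = U; last by split.
by apply/seteqP; split=> [_ [p Up <-]|p Up]; [|exists p => //]; rewrite castmx_id.
Qed.

Theorem theorem1p3 (R : realType) (d k : nat) (hk : (1 <= k)%N) (hkd : (k < d)%N)
    (S : set 'M[R]_(k.+1, d - k)) (alpha : R)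
    (hS : compact S)
    (hdim : hausdorff_dim (@euclidean_dist R k.+1 (d - k)) S = alpha%:E)
    (halpha : ((k.+1 * (d - k))%N)%:R - k%:R < alpha) :
  (@lebesgue_outer R d).-cara.-measurable (\bigcup_(y in S) plane hkd y) /\
  (0 < lebesgue_measure_rV (\bigcup_(y in S) plane hkd y))%E.
Proof.
have m0 : (0 < d - k)%N by rewrite subn_gt0.
have planeE y : plane hkd y = [set castmx (erefl 1%N, subnKC (ltnW hkd)) p | p in range (plane_point y)].
  by rewrite image_comp.
under eq_bigcupr do rewrite planeE.
rewrite -image_bigcup.
rewrite /lebesgue_measure_rV; apply: castmx_measurable_pos; first exact: union_measurable.
rewrite lt_neqAle outer_measure_ge0 andbT eq_sym; apply/negP => /eqP null.
set N := (k.+1 * (d - k))%N in halpha.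
have NkN : N%:R - k%:R < N%:R :> R by rewrite ltrBlDr ltrDl ltr0n.
have Nk0 : 0 <= N%:R - k%:R :> R by rewrite subr_ge0 ler_nat /N -{1}[k]muln1 leq_mul.
(* The midpoint lies strictly between N - k >= 0 and alpha, and the minimum keeps it at most N; a
   null union would then force the dimension down to s < alpha. *)
pose s := (N%:R - k%:R + Num.min alpha N%:R) / 2.
have mA : Num.min alpha N%:R <= alpha by rewrite ge_min lexx.
have mN : Num.min alpha N%:R <= N%:R by rewrite ge_min lexx orbT.
have mk : N%:R - k%:R < Num.min alpha N%:R by rewrite lt_min halpha.
have sk : N%:R - k%:R < s by rewrite /s; lra.
have sN : s <= N%:R by rewrite /s; lra.
have sa : s < alpha by rewrite /s; lra.
have s0 : 0 < s by apply: le_lt_trans sk.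
have H := union_null_dim hS m0 hk null sk sN s0.
have : (hausdorff_dim (@euclidean_dist R k.+1 (d - k)) S <= s%:E)%E.
  by apply: ereal_inf_lbound; exists s => //; split => //; exact: ltW.
by rewrite hdim lee_fin leNgt sa.
Qed.
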